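(* There exist absolute constants $C>0$ and $p_0$ such that for every prime $p\ge p_0$ and every integer $N$ with $2\le N<p$, $$\max_{(a,p)=1}\left|\sum_{n\le N}e_p(an^* )\right|\le C\,\frac{(\log\log p)^3\log p}{(\log N)^{3/2}}\,N.$$
   Context: The sum is over positive integers $n\le N$; $n^*$ is the multiplicative inverse of $n$ modulo $p$; $e_p(z)=e^{2\pi i z/p}$. The maximum is over integers $a$ coprime to $p$. *)

(* Defs.v *)
From HB Require Import structures.
From mathcomp Require Import all_boot all_order all_algebra.
From mathcomp Require Import complex.
From mathcomp Require Import all_classical all_reals all_analysis.

Set Implicit Arguments.
Unset Strict Implicit.
Unset Printing Implicit Defensive.

Import Order.TTheory GRing.Theory Num.Theory.
Import ComplexField.
Local Open Scope classical_set_scope.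
Local Open Scope ring_scope.

Definition e_mod (R : realType) (p : nat) (z : int) : R[i] :=
  let t : R := 2 * pi * z%:~R / p%:R in Complex (cos t) (sin t).

(* The representative of n^* in [0, p). For p prime 'F_p is the field Z/pZ;
   when p divides n the value is 0. *)
Definition inv_mod (p n : nat) : nat := (n%:R^-1 : 'F_p)%R.

Definition kloosterman_sum (R : realType) (p N : nat) (a : int) : R[i] :=
  \sum_(1 <= n < N.+1) e_mod R p (a * (inv_mod p n)%:Z).

(* The supremum runs over infinitely many integers a, but it is attained: see
   max_kloosterman_attained below. *)
Definition max_kloosterman (R : realType) (p N : nat) : R :=
  sup [set Normc.normc (kloosterman_sum R p N a) |
       a in [set a : int | coprimez a p%:Z]].

Lemma inv_modP (p n : nat) : prime p -> coprime n p ->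
  n * inv_mod p n = 1 %[mod p].
Proof.
move=> pp cop.
have: (n%:R * n%:R^-1 : 'F_p) = 1.
  by rewrite divff // -(dvdn_pcharf (pchar_Fp pp)) -prime_coprime // coprime_sym.
rewrite -[X in _ * X]natr_Zp -natrM -[1]/(1%:R).
by move=> /(congr1 (@nat_of_ord _)); rewrite !(val_Fp_nat pp).
Qed.

Lemma e_modD (R : realType) (p : nat) (x y : int) :
  e_mod R p (x + y) = e_mod R p x * e_mod R p y.
Proof.
rewrite /e_mod intrD mulrDr mulrDl cosD sinD.
by apply/eqP; rewrite eq_complex /= eqxx addrC mulrC eqxx.
Qed.

Lemma e_mod_period (R : realType) (p : nat) (k : int) : (0 < p)%N ->
  e_mod R p (k * p%:Z) = 1.
Proof.
move=> p0; have pn0 : (p%:R : R) != 0 by rewrite pnatr_eq0 -lt0n.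
have h (m : nat) : e_mod R p (m%:Z * p%:Z) = 1.
  elim: m => [|m IH].
    by rewrite mul0r /e_mod mulr0 mul0r cos0 sin0.
  rewrite -addn1 PoszD mulrDl e_modD IH !mul1r /e_mod.
  by rewrite -mulrA divff // mulr1 mulr_natl cos2pi sin2pi.
case: k => m; first exact: h.
have := e_modD R p (m.+1%:Z * p%:Z) (Negz m * p%:Z).
rewrite -mulrDl NegzE subrr mul0r h mul1r => <-.
by rewrite /e_mod mulr0 mul0r cos0 sin0.
Qed.

Lemma kloosterman_sum_modz (R : realType) (p N : nat) (a : int) : (0 < p)%N ->
  kloosterman_sum R p N (a %% p%:Z)%Z = kloosterman_sum R p N a.
Proof.
move=> p0; apply: eq_bigr => n _; rewrite [in RHS](divz_eq a p%:Z).
by rewrite [in RHS]mulrDl e_modD [in RHS]mulrAC e_mod_period // mul1r.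
Qed.

Lemma max_kloosterman_attained (R : realType) (p N : nat) : prime p ->
  (exists2 a : int, coprimez a p%:Z &
     max_kloosterman R p N = Normc.normc (kloosterman_sum R p N a)) /\
  (forall a : int, coprimez a p%:Z ->
     Normc.normc (kloosterman_sum R p N a) <= max_kloosterman R p N).
Proof.
move=> pp; have p0 := prime_gt0 pp; have p1 := prime_gt1 pp.
pose F (a : int) : R := Normc.normc (kloosterman_sum R p N a).
have c1 : coprimez (Ordinal p1 : nat)%:Z p%:Z by rewrite coprimezE /= coprime1n.
have [b cb bmax] := @arg_maxP _ R 'I_p (Ordinal p1)
  (fun i => coprimez (i : nat)%:Z p%:Z) (fun i => F (i : nat)%:Z) c1.
have ub (a : int) : coprimez a p%:Z -> F a <= F (b : nat)%:Z.
  move=> ca; rewrite /F -(kloosterman_sum_modz R N a p0).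
  have pz : p%:Z != 0 by rewrite eqz_nat -lt0n.
  have /gez0_abs e := modz_ge0 a pz.
  have lt : (`|(a %% p%:Z)%Z| < p)%N by rewrite -ltz_nat e ltz_pmod.
  rewrite -e; apply: (bmax (Ordinal lt)) => /=.
  by rewrite e /coprimez gcdz_modl.
have sE : max_kloosterman R p N = F (b : nat)%:Z.
  apply/eqP; rewrite eq_le; apply/andP; split.
    by apply: ge_sup => [|_ [a /= ca <-]]; [exists (F b%:Z), b%:Z | exact: ub].
  apply: ub_le_sup; last by exists b%:Z.
  by exists (F b%:Z) => _ [a /= ca <-]; exact: ub.
by split; [exists b%:Z | move=> a ca; rewrite sE; exact: ub].
Qed.

(* Main.v *)
(* The idea, with L = log_2 p. Writing log n as the sum of log q over the primes q | n, up to O(1)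
   on average, and doing it once more for n / q, reduces the sum to bilinear sums of
   psi (1 / (m q r)), psi an additive character of F_p, over primes q ~ 2^i and r ~ 2^j; there is
   no loss beyond the trivial bound on the discarded q and r.
   A k-fold sum of reciprocals of primes q ~ 2^i takes a given value modulo p at most about
   k^k (1 + 4^k 2^(i(2k-1)) / p) times: distinct rational sums which agree modulo p are at least
   p / 2^(2k(i+1)) apart, and a rational sum determines its primes. By Hoelder and Parseval, with
   k ~ L / 2i and l ~ L / 2j, the bilinear sum saves any power of L, unless j is within
   C k log L of one of the points L / 2l; given i, this excludes O(L log L / sqrt i) values of j.
   By Chebyshev every dyadic box of primes has O(1) logarithmic mass, so that the excluded part is
   N / log N times the sum over i of L log L / (sqrt i (log_2 N - i)), that is, at most
   N L (log L)^2 / (log N)^(3/2) up to a constant. *)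
Require Import Defs.
From mathcomp Require Import all_boot all_order all_algebra.
From mathcomp Require Import complex.
From mathcomp Require Import all_classical all_reals all_analysis.
From mathcomp Require Import zify ring lra.
Import Order.TTheory GRing.Theory Num.Theory.
Set Implicit Arguments.
Unset Strict Implicit.
Unset Printing Implicit Defensive.
Local Open Scope ring_scope.

(** * Dyadic levels of primes and Chebyshev's bounds on a single level *)

(* The level of a prime r is the j such that r lies in ]2^j, 2^(j+1)]. *)
Definition lev (r : nat) : nat := trunc_log 2 r.-1.

Lemma lev_bounds r : (1 < r)%N -> (2 ^ lev r < r <= 2 ^ (lev r).+1)%N.
Proof.
move=> r1; have r0 : (0 < r.-1)%N by lia.
by have /andP[] := trunc_log_bounds (isT : 1 < 2)%N r0; rewrite -/(lev r); lia.
Qed.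

Lemma primorial_dvdn (s : seq nat) m : uniq s -> all prime s ->
  all (fun r => (r %| m)%N) s -> ((\prod_(r <- s) r)%N %| m)%N.
Proof.
elim: s => [|r s IH] /=; first by rewrite big_nil dvd1n.
move=> /andP[rs us] /andP[pr ps] /andP[rm sm].
rewrite big_cons Gauss_dvd ?rm ?IH // big_seq.
apply: (big_ind (coprime r)) => [|x y|x xs]; first by rewrite coprimen1.
  by rewrite coprimeMr => -> ->.
rewrite prime_coprime // dvdn_prime2 ?(allP ps x) //.
by apply: contraNneq rs => ->.
Qed.

(** Such an r divides (2n)! but not n!, and (2n)! = C(2n, n) n! n!. *)
Lemma prime_dvdn_central_bin n r : prime r -> (n < r <= n + n)%N ->
  (r %| 'C(n + n, n))%N.
Proof.
move=> pr /andP[nr rn].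
have := bin_fact (leq_addr n n); rewrite addnK => e.
have : (r %| (n + n)`!)%N by rewrite dvdn_fact // prime_gt0.
have nf : ~~ (r %| n`!)%N.
  elim: {rn e} n nr => [|n IH] nr; first by rewrite Euclid_dvd1.
  by rewrite factS Euclid_dvdM // negb_or gtnNdvd // IH // ltnW.
by rewrite -e !Euclid_dvdM // (negbTE nf) !orbF.
Qed.

Section Chebyshev.
Variable R : realType.

Lemma ln_nat_ge0 n : 0 <= ln (n%:R : R).
Proof. by case: n => [|n]; [rewrite ln0 | rewrite ln_ge0 ?ler1n]. Qed.

Lemma ln_prodn (s : seq nat) : all (leq 1) s ->
  ln ((\prod_(r <- s) r)%N%:R : R) = \sum_(r <- s) ln r%:R.
Proof.
elim: s => [|r s IH] /=; first by rewrite !big_nil ln1.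
move=> /andP[r1 s1]; rewrite !big_cons natrM lnM ?IH ?posrE ?ltr0n //.
rewrite big_seq; apply: (big_ind (leq 1)) => // [x y|x /(allP s1)//].
by rewrite muln_gt0 => -> ->.
Qed.

(** With n = 2^j, the primes of level j lie in ]n, 2n], so that their product divides C(2n, n),
    which is at most 2^(2n). *)
Lemma box_theta T j :
  \sum_(1 <= r < T.+1 | prime r && (lev r == j)) ln (r%:R : R) <=
  (2 ^ j.+1)%:R * ln 2.
Proof.
rewrite -big_filter; set s := [seq _ <- _ | _].
have sP r : r \in s -> prime r /\ (2 ^ j < r <= 2 ^ j + 2 ^ j)%N.
  rewrite mem_filter => /andP[/andP[pr /eqP <-] _]; split=> //.
  by have := lev_bounds (prime_gt1 pr); rewrite expnS; lia.
rewrite -ln_prodn; last by apply/allP => r /sP[/prime_gt0].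
have d : ((\prod_(r <- s) r)%N %| 'C(2 ^ j + 2 ^ j, 2 ^ j))%N.
  apply: primorial_dvdn; first by rewrite filter_uniq ?iota_uniq.
    by apply/allP => r /sP[].
  by apply/allP => r /sP[pr /prime_dvdn_central_bin ->].
have s0 : (0 < \prod_(r <- s) r)%N.
  rewrite big_seq; apply: (big_ind (leq 1)) => // [x y|x /sP[/prime_gt0//]].
  by rewrite muln_gt0 => -> ->.
have le : (\prod_(r <- s) r <= 2 ^ (2 ^ j + 2 ^ j))%N.
  apply: leq_trans (dvdn_leq _ d) _; first by rewrite bin_gt0 leq_addr.
  (* The central coefficient is one term of the binomial expansion of (1 + 1)^(2n). *)
  rewrite [X in (_ <= X)%N](Pascal 1 1 (2 ^ j + 2 ^ j)).
  have lt : (2 ^ j < (2 ^ j + 2 ^ j).+1)%N by lia.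
  rewrite (bigD1 (Ordinal lt)) //= !exp1n !muln1; exact: leq_addr.
have -> : (2 ^ j.+1)%:R * ln 2 = ln ((2 ^ (2 ^ j + 2 ^ j))%:R : R).
  by rewrite [in RHS]natrX lnXn ?ltr0n // mulr_natl expnS mul2n addnn.
by rewrite ler_ln ?posrE ?ltr0n ?expn_gt0 // ler_nat.
Qed.

(** Every r of level j exceeds 2^j, so dividing by r gains a factor 2^j over [box_theta]. The result
    is uniform in j. *)
Lemma box_mertens T j :
  \sum_(1 <= r < T.+1 | prime r && (lev r == j)) ln (r%:R : R) / r%:R <= 2 * ln 2.
Proof.
have j0 : (0 : R) < (2 ^ j)%:R by rewrite ltr0n expn_gt0.
rewrite -(ler_pM2l j0) mulr_sumr; apply: le_trans (_ : (2 ^ j.+1)%:R * ln 2 <= _); last first.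
  by rewrite expnS natrM; lra.
apply: le_trans (box_theta T j); apply: ler_sum => r /andP[pr /eqP jr].
rewrite mulrCA ler_piMr ?ln_nat_ge0 // ler_pdivrMr ?mul1r ?ltr0n ?prime_gt0 //.
by rewrite ler_nat -jr; have := lev_bounds (prime_gt1 pr); lia.
Qed.

End Chebyshev.

(** * The modulus of a complex number as a real number *)

Section Normc.
Variable R : realType.
Local Notation nc := (@Normc.normc R).
Implicit Types (x : R) (z w : R[i]).

Lemma normc_ge0 z : 0 <= nc z.
Proof. by case: z => a b; exact: sqrtr_ge0. Qed.

Lemma normcD z w : nc (z + w) <= nc z + nc w.
Proof. exact: (@le_normcD R z w). Qed.

Lemma normc_sum (I : Type) (s : seq I) (P : pred I) (F : I -> R[i]) :
  nc (\sum_(i <- s | P i) F i) <= \sum_(i <- s | P i) nc (F i).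
Proof.
apply: (big_ind2 (fun z y => nc z <= y)) => //; first by rewrite Normc.normc0.
by move=> a x b y ha hb; apply: le_trans (normcD _ _) (lerD ha hb).
Qed.

Lemma normc_real x : nc (x%:C)%C = `|x|.
Proof. by rewrite /= expr0n /= addr0 sqrtr_sqr. Qed.

Lemma normcX z n : nc (z ^+ n) = nc z ^+ n.
Proof.
elim: n => [|n IH]; first by rewrite !expr0 Normc.normc1.
by rewrite !exprS Normc.normcM IH.
Qed.

Lemma normc_prod_le1 (I : Type) (s : seq I) (P : pred I) (F : I -> R[i]) :
  (forall i, P i -> nc (F i) <= 1) -> nc (\prod_(i <- s | P i) F i) <= 1.
Proof.
move=> h; apply: (big_ind (fun z => nc z <= 1)) => //; first by rewrite Normc.normc1.
move=> a b ha hb; rewrite Normc.normcM.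
by rewrite -[1]mulr1 ler_pM ?normc_ge0.
Qed.

End Normc.

(** * Replacing log T, on average over m <= T, by the sum of log r over the primes r dividing m *)

Lemma big_nat_dvdn (V : nmodType) (g : nat -> V) T r : (0 < r)%N ->
  \sum_(1 <= m < T.+1 | (r %| m)%N) g m = \sum_(1 <= m < (T %/ r).+1) g (r * m)%N.
Proof.
move=> r0; elim: T => [|T IH]; first by rewrite div0n !big_geq.
rewrite big_mkcond big_nat_recr //= -big_mkcond /= IH divnS //.
case: ifP => rT; last by rewrite add0n addr0.
rewrite add1n [RHS]big_nat_recr //=; congr (_ + g _).
have -> : (T %/ r).+1 = (T.+1 %/ r)%N by rewrite divnS // rT add1n.
by rewrite mulnC divnK.
Qed.

Lemma sum_lev (V : nmodType) T n (F : nat -> V) :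
  (forall r, (1 < r <= T)%N -> (lev r < n)%N) ->
  \sum_(1 <= r < T.+1 | prime r) F r =
  \sum_(j < n) \sum_(1 <= r < T.+1 | prime r && (lev r == j)) F r.
Proof.
move=> h; rewrite (exchange_big_dep prime) /=; last by move=> i r _ /andP[].
rewrite big_nat_cond [RHS]big_nat_cond.
apply: eq_bigr => r /andP[/andP[r1 rT] pr].
have rn : (lev r < n)%N by apply: h; rewrite prime_gt1.
rewrite (big_pred1 (Ordinal rn)) // => i /=.
by rewrite pr -val_eqE eq_sym.
Qed.

Section LogWeight.
Variable R : realType.
Local Notation nc := (@Normc.normc R).

Lemma ln2_le1 : ln (2 : R) <= 1.
Proof.
by have -> : (2 : R) = 1 + 1 by []; apply: le_ln1Dx; lra.
Qed.

(** The elementary half of Stirling's formula. Passing from T to T + 1 adds T (ln (T + 1) - ln T),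
    which is at most 1. *)
Lemma sum_ln_quot T : \sum_(1 <= m < T.+1) (ln (T%:R : R) - ln m%:R) <= T%:R.
Proof.
elim: T => [|T IH]; first by rewrite big_geq.
rewrite big_nat_recr //= subrr addr0.
have [->|T0] := posnP T; first by rewrite big_geq.
have t0 : (0 : R) < T%:R by rewrite ltr0n.
have -> : \sum_(1 <= m < T.+1) (ln (T.+1%:R : R) - ln m%:R) =
    (ln T.+1%:R - ln T%:R) * T%:R + \sum_(1 <= m < T.+1) (ln (T%:R : R) - ln m%:R).
  have -> : (ln T.+1%:R - ln T%:R) * T%:R = \sum_(1 <= m < T.+1) (ln T.+1%:R - ln (T%:R : R)).
    by rewrite big_const_nat subn1 /= iter_addr_0 mulr_natr.
  by rewrite -big_split /=; apply: eq_bigr => m _; ring.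
rewrite -[X in _ <= X]natr1 [leRHS]addrC lerD // -ler_pdivlMr // mul1r -ln_div ?posrE ?ltr0n //.
rewrite -natr1 mulrDl divff ?gt_eqF // mul1r; apply: le_ln1Dx.
have : (0 : R) < T%:R^-1 by rewrite invr_gt0.
by lra.
Qed.

Lemma ln_factorization T m : (0 < m <= T)%N ->
  ln (m%:R : R) = \sum_(1 <= r < T.+1 | prime r) (logn r m)%:R * ln r%:R.
Proof.
move=> /andP[m0 mT]; rewrite -{1}(partnT m0) (widen_partn predT mT) /=.
rewrite (big_ltn (ltn0Sn T)) /= [logn 0 m]lognE /= mul1n.
have -> : ln ((\prod_(1 <= r < T.+1) r ^ logn r m)%N%:R : R) =
    \sum_(1 <= r < T.+1) ln ((r ^ logn r m)%N%:R : R).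
  have := @ln_prodn R [seq (r ^ logn r m)%N | r <- index_iota 1 T.+1].
  rewrite !big_map => -> //; apply/allP => _ /mapP[r + ->].
  by rewrite mem_index_iota expn_gt0 => /andP[-> _].
rewrite [RHS]big_mkcond [LHS]big_nat_cond [RHS]big_nat_cond.
apply: eq_bigr => r /andP[/andP[r0 rT] _]; case: ifP => pr.
  by rewrite natrX lnXn ?ltr0n // mulr_natl.
by rewrite lognE pr expn0 ln1.
Qed.

(** By Legendre's formula the first sum is that of the T / r^k rounded down, and k = 1 counts the
    multiples of r. The terms k >= 2 form a geometric series of sum at most T / (r (r - 1)), and r -
    1 >= 2^(lev r). The power of 2 is kept so that the levels can be summed afterwards. *)
Lemma sum_logn_excess T r : prime r ->
  \sum_(1 <= m < T.+1) ((logn r m)%:R - (r %| m)%:R : R) <=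
  T%:R / (r%:R * (2 ^ lev r)%:R).
Proof.
move=> pr; have r1 := prime_gt1 pr; have r0 : (0 : R) < r%:R by rewrite ltr0n ltnW.
have r10 : (0 : R) < r%:R - 1 by rewrite subr_gt0 ltr1n.
have logE : (\sum_(1 <= m < T.+1) logn r m = \sum_(1 <= k < T.+1) T %/ r ^ k)%N.
  rewrite -logn_fact //; elim: T => [|T IH]; first by rewrite big_geq // logn1.
  by rewrite big_nat_recr //= IH factS mulnC lognM ?fact_gt0.
have dvdE : (\sum_(1 <= m < T.+1) (r %| m) = T %/ r)%N.
  rewrite -big_mkcond /= big_nat_dvdn ?(ltnW r1) //.
  by rewrite sum_nat_const_nat subn1 muln1.
rewrite sumrB -!natr_sum logE dvdE.
have [->|T0] := posnP T; first by rewrite big_geq // div0n subrr mul0r.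
rewrite big_ltn // expn1 natrD addrAC subrr add0r natr_sum.
have geo n : \sum_(2 <= k < n.+2) (r%:R ^- k : R) <=
    (r%:R * (r%:R - 1))^-1 - (r%:R ^+ n * (r%:R * (r%:R - 1)))^-1.
  elim: n => [|n IH]; first by rewrite big_geq // expr0 mul1r subrr.
  rewrite big_nat_recr //=; apply: le_trans (lerD IH (lexx _)) _.
  rewrite -addrA lerD2l -subr_ge0 le_eqVlt; apply/orP; left; apply/eqP.
  rewrite !exprS; field; rewrite !gt_eqF ?exprn_gt0 //.
apply: le_trans (_ : T%:R * (r%:R * (r%:R - 1))^-1 <= _).
  apply: le_trans (_ : T%:R * \sum_(2 <= k < T.+2) (r%:R ^- k : R) <= _).
    rewrite mulr_sumr; apply: le_trans (_ : \sum_(2 <= k < T.+1) T%:R / r%:R ^+ k <= _).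
      apply: ler_sum => k _; rewrite ler_pdivlMr ?exprn_gt0 // -natrX -natrM ler_nat.
      exact: leq_trunc_div.
    rewrite [leRHS]big_nat_recr ?ltnS //= lerDl.
    by rewrite divr_ge0 // exprn_ge0 // ltW.
  rewrite ler_wpM2l //; apply: le_trans (geo T) _.
  by rewrite gerBl invr_ge0 !mulr_ge0 ?exprn_ge0 // ltW.
rewrite ler_wpM2l // lef_pV2 ?posrE ?mulr_gt0 ?ltr0n ?expn_gt0 //.
  by rewrite ler_pM2l // -[1]/(1%:R) -natrB ?(ltnW r1) // ler_nat; have := lev_bounds r1; lia.
all: exact: ltnW.
Qed.

(** Higher prime powers matter little: by [sum_logn_excess] and [box_mertens], level j contributes
    at most 2 ln 2 T / 2^j. *)
Lemma sum_ln_excess T :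
  \sum_(1 <= m < T.+1)
     (ln (m%:R : R) - \sum_(1 <= r < T.+1 | prime r && (r %| m)%N) ln r%:R)
  <= 4 * T%:R.
Proof.
have -> : \sum_(1 <= m < T.+1)
     (ln (m%:R : R) - \sum_(1 <= r < T.+1 | prime r && (r %| m)%N) ln r%:R) =
   \sum_(1 <= r < T.+1 | prime r) ln r%:R * \sum_(1 <= m < T.+1) ((logn r m)%:R - (r %| m)%:R).
  under [RHS]eq_bigr do rewrite mulr_sumr.
  rewrite [RHS]exchange_big /= big_nat_cond [RHS]big_nat_cond.
  apply: eq_bigr => m /andP[/andP[m1 mT] _]; rewrite (@ln_factorization T); last by rewrite m1.
  rewrite big_mkcondr -sumrB; apply: eq_bigr => r _.
  by case: (r %| m)%N => /=; ring.
apply: le_trans (_ : \sum_(1 <= r < T.+1 | prime r) T%:R * (ln r%:R / r%:R * (2 ^ lev r)%:R^-1) <= _).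
  apply: ler_sum => r pr; apply: le_trans (ler_wpM2l (ln_nat_ge0 _ _) (sum_logn_excess T pr)) _.
  rewrite le_eqVlt; apply/orP; left; apply/eqP. field.
  by rewrite !pnatr_eq0 -!lt0n expn_gt0 (prime_gt0 pr).
rewrite -mulr_sumr mulrC ler_wpM2r // (@sum_lev _ T T); last first.
  move=> r /andP[r1 rT]; apply: leq_trans rT; apply: ltn_trans (ltn_expl _ (ltnSn 1)) _.
  by have /andP[] := lev_bounds r1.
apply: le_trans (_ : \sum_(j < T) (2 * ln 2) * (2 ^ j)%:R^-1 <= _).
  apply: ler_sum => j _; apply: le_trans (ler_wpM2r _ (box_mertens R T j)); last first.
    by rewrite invr_ge0.
  by rewrite mulr_suml; apply: ler_sum => r /andP[_ /eqP ->].
rewrite -mulr_sumr.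
have geo n : \sum_(j < n) (2 ^ j)%:R^-1 = 2 - 2 * (2 ^ n)%:R^-1 :> R.
  elim: n => [|n IH]; first by rewrite big_ord0 expn0; lra.
  rewrite big_ord_recr /= IH expnS natrM; field.
  by rewrite pnatr_eq0 -lt0n expn_gt0.
rewrite geo; have := ln2_le1; have : 0 <= ln (2 : R) by exact: (ln_nat_ge0 R 2).
have : 0 <= (2 ^ T)%:R^-1 :> R by rewrite invr_ge0.
by move=> a b c; nra.
Qed.

Lemma ln_radical_le T m : (0 < m <= T)%N ->
  \sum_(1 <= r < T.+1 | prime r && (r %| m)%N) ln (r%:R : R) <= ln m%:R.
Proof.
move=> mT; rewrite (ln_factorization mT) big_mkcondr; apply: ler_sum => r pr.
case: ifP => rm; last by rewrite mulr_ge0 ?ln_nat_ge0.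
rewrite ler_peMl ?ln_nat_ge0 // ler1n logn_gt0 mem_primes pr rm.
by case/andP: mT => ->.
Qed.

(** Let w m be the sum of ln r over the primes r dividing m. Then ln T - w m is the sum of the
    nonnegative numbers ln T - ln m and ln m - w m, whose totals are at most T and 4 T. With the
    weight w m in place of ln T, exchanging r and m gives the last sum. This is applied twice: to
    the whole sum, and then to the inner sum attached to each prime q. *)
Lemma log_weight (g : nat -> R[i]) T : (forall n, nc (g n) <= 1) ->
  ln T%:R * nc (\sum_(1 <= m < T.+1) g m) <=
  5 * T%:R +
  nc (\sum_(1 <= r < T.+1 | prime r)
         (ln r%:R)%:C%C * \sum_(1 <= m < (T %/ r).+1) g (r * m)%N).
Proof.
move=> g1; pose w m : R := \sum_(1 <= r < T.+1 | prime r && (r %| m)%N) ln (r%:R : R).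
have -> : \sum_(1 <= r < T.+1 | prime r)
         (ln r%:R)%:C%C * \sum_(1 <= m < (T %/ r).+1) g (r * m)%N =
    \sum_(1 <= m < T.+1) (w m)%:C%C * g m.
  under [RHS]eq_bigr => m _ do rewrite /w rmorph_sum mulr_suml big_mkcondr /=.
  rewrite [RHS]exchange_big /=; apply: eq_bigr => r pr.
  rewrite -big_nat_dvdn ?prime_gt0 // mulr_sumr big_mkcond /=.
  by apply: eq_bigr => m _; case: (_ %| _)%N.
have -> : ln T%:R * nc (\sum_(1 <= m < T.+1) g m) =
    nc (\sum_(1 <= m < T.+1) (ln T%:R)%:C%C * g m).
  by rewrite -mulr_sumr Normc.normcM normc_real ger0_norm ?ln_nat_ge0.
have -> : \sum_(1 <= m < T.+1) (ln T%:R)%:C%C * g m =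
    \sum_(1 <= m < T.+1) (ln T%:R - w m)%:C%C * g m + \sum_(1 <= m < T.+1) (w m)%:C%C * g m.
  by rewrite -big_split /=; apply: eq_bigr => m _; rewrite -mulrDl -rmorphD subrK.
apply: le_trans (normcD _ _) _; rewrite lerD2r.
apply: le_trans (normc_sum _ _ _) _.
apply: le_trans (_ : \sum_(1 <= m < T.+1) ((ln T%:R - ln m%:R) + (ln m%:R - w m)) <= _).
  rewrite big_nat_cond [leRHS]big_nat_cond; apply: ler_sum => m /andP[/andP[m1 mT] _].
  have h1 : w m <= ln m%:R by apply: ln_radical_le; rewrite m1.
  have h2 : ln (m%:R : R) <= ln T%:R by rewrite ler_ln ?posrE ?ltr0n ?ler_nat //; lia.
  rewrite Normc.normcM normc_real ger0_norm; last by lra.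
  apply: le_trans (ler_wpM2l _ (g1 m)) _; lra.
rewrite big_split /=; have := sum_ln_quot T; have := sum_ln_excess T.
rewrite -/w => a b; lra.
Qed.

End LogWeight.

(** Hoelder's inequality, by induction on n. The step is Chebyshev's sum inequality: twice the
    difference is a symmetric double sum of w_i w_j (t_i^(n+1) - t_j^(n+1)) (t_i - t_j), and both
    differences have the same sign. *)
Lemma power_mean (R : realDomainType) (I : finType) (P : pred I) (w t : I -> R) n :
  (forall i, P i -> 0 <= w i) -> (forall i, P i -> 0 <= t i) ->
  (\sum_(i | P i) w i * t i) ^+ n.+1 <=
  (\sum_(i | P i) w i) ^+ n * \sum_(i | P i) w i * t i ^+ n.+1.
Proof.
move=> w0 t0; elim: n => [|n IH].
  by rewrite expr0 mul1r expr1; under [leRHS]eq_bigr do rewrite expr1.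
have W0 : 0 <= \sum_(i | P i) w i by apply: sumr_ge0.
have S0 : 0 <= \sum_(i | P i) w i * t i by apply: sumr_ge0 => i Pi; rewrite mulr_ge0 ?w0 ?t0.
rewrite exprSr; apply: le_trans (ler_wpM2r S0 IH) _.
rewrite [in leRHS]exprSr -!mulrA ler_wpM2l ?exprn_ge0 //.
suff : 0 <= ((\sum_(i | P i) w i) * \sum_(i | P i) w i * t i ^+ n.+2 -
  (\sum_(i | P i) w i * t i ^+ n.+1) * \sum_(i | P i) w i * t i) *+ 2.
  by rewrite pmulrn_lge0 ?subr_ge0.
have -> : ((\sum_(i | P i) w i) * \sum_(i | P i) w i * t i ^+ n.+2 -
  (\sum_(i | P i) w i * t i ^+ n.+1) * \sum_(i | P i) w i * t i) *+ 2 =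
  \sum_(i | P i) \sum_(j | P j) w i * w j * ((t i ^+ n.+1 - t j ^+ n.+1) * (t i - t j)).
  rewrite mulr2n {1}[X in X - _]mulrC {1}[X in _ - X + _]mulrC.
  rewrite !big_distrlr /= -!sumrB -big_split; apply: eq_bigr => i _ /=.
  by rewrite -!sumrB -big_split; apply: eq_bigr => j _ /=; rewrite !exprS; ring.
apply: sumr_ge0 => i Pi; apply: sumr_ge0 => j Pj; apply: mulr_ge0; first by rewrite mulr_ge0 ?w0.
have [le|/ltW le] := leP (t i) (t j).
  by apply: mulr_le0; rewrite subr_le0 // lerXn2r ?nnegrE ?t0.
by apply: mulr_ge0; rewrite subr_ge0 // lerXn2r ?nnegrE ?t0.
Qed.

(** * Coincidences modulo p between sums of reciprocals of primes *)

Section Reciprocals.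
Variables (p : nat) (l : nat).
Implicit Types f : {ffun 'I_l -> 'I_p}.

(** The field is a parameter because the same tuple is summed both in ['F_p] and in the reals; the
    two sums are then compared. *)
Definition recip_sum (K : fieldType) f : K := \sum_i (f i : nat)%:R^-1.

Definition recip_num f : nat := \sum_i \prod_(j | j != i) f j.

Lemma recip_sumE (K : fieldType) f : (forall i, (f i : nat)%:R != 0 :> K) ->
  recip_sum K f = (recip_num f)%:R / (\prod_i (f i : nat))%N%:R.
Proof.
move=> f0; rewrite /recip_sum /recip_num natr_sum mulr_suml; apply: eq_bigr => i _.
rewrite [X in _ / X%:R](bigD1 i) //= natrM invfM mulrCA divff ?mulr1 //.
by rewrite natr_prod; apply/prodf_neq0 => j _.
Qed.

Lemma prime_notin_prod q (I : finType) (P : pred I) (F : I -> nat) : prime q ->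
  (forall i, P i -> prime (F i)) -> (forall i, P i -> F i != q) ->
  ~~ (q %| \prod_(i | P i) F i)%N.
Proof.
move=> pq pF Fq; rewrite -prime_coprime //.
apply: (big_ind (coprime q)) => [|x y|i Pi]; first by rewrite coprimen1.
  by rewrite coprimeMr => -> ->.
by rewrite prime_coprime // dvdn_prime2 ?pF // eq_sym Fq.
Qed.

Variable R : realType.

(* Otherwise f' i occurs with multiplicity c < f' i, and multiplying the equality by the other
   primes makes c times a product prime to f' i divisible by f' i. *)
Lemma recip_sum_codom f f' :
  (forall i, prime (f i)) -> (forall i, prime (f' i)) -> (forall i, (l < f' i)%N) ->
  recip_sum R f = recip_sum R f' -> forall i, f' i \in codom f.
Proof.
move=> pf pf' lf' e i0; apply/negPn/negP => nc; set q := nat_of_ord (f' i0).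
have pq : prime q := pf' i0.
have fq j : nat_of_ord (f j) != q.
  by apply: contraNneq nc => /val_inj <-; exact: codom_f.
pose N := (\prod_j (f j : nat) * \prod_(i | nat_of_ord (f' i) != q) (f' i : nat))%N.
pose c := #|[pred i | nat_of_ord (f' i) == q]|.
have qN : ~~ (q %| N)%N.
  by rewrite Euclid_dvdM // negb_or !prime_notin_prod // => i _.
have qc : ~~ (q %| c)%N.
  rewrite gtnNdvd //; first by apply/card_gt0P; exists i0; rewrite inE /=.
  by apply: leq_ltn_trans (lf' i0); rewrite -[l in X in (_ <= X)%N]card_ord; exact: max_card.
have : (c * N)%:R / q%:R \is a @Num.int R.
  have -> : (c * N)%:R / q%:R = \sum_j N%:R / (f j : nat)%:R -
      \sum_(i | nat_of_ord (f' i) != q) N%:R / (f' i : nat)%:R :> R.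
    rewrite -!mulr_sumr -/(recip_sum R f) e /recip_sum (bigID (fun i => nat_of_ord (f' i) == q)) /=.
    under eq_bigr => i /eqP -> do [].
    rewrite sumr_const mulrDr addrK -/c natrM -[q%:R^-1 *+ c]mulr_natl; ring.
  have i1 : \sum_j N%:R / (f j : nat)%:R \is a @Num.int R;
    [apply: rpred_sum => i _ | rewrite rpredB ?i1 //; apply: rpred_sum => i Pi].
    rewrite /N (bigD1 i) //= -mulnA natrM mulrAC divff ?mul1r ?rpred_nat //.
    by rewrite pnatr_eq0 -lt0n prime_gt0.
  rewrite /N [X in (_ * X)%N](bigD1 i) //= mulnCA natrM mulrAC divff ?mul1r ?rpred_nat //.
  by rewrite pnatr_eq0 -lt0n prime_gt0.
move=> /intrP[z] /(congr1 (fun x => x * q%:R)).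
rewrite mulfVK ?pnatr_eq0 -?lt0n ?prime_gt0 // => /eqP.
rewrite !pmulrn -intrM eqr_int => /eqP ez.
have : (q %| c * N)%N.
  by apply/dvdnP; exists `|z|%N; apply/eqP; rewrite -eqz_nat ez PoszM; lia.
by rewrite Euclid_dvdM // (negbTE qN) (negbTE qc).
Qed.

Hypothesis pp : prime p.

Lemma Fp_ord_neq0 (x : 'I_p) : prime x -> (x : nat)%:R != 0 :> 'F_p.
Proof.
by move=> px; rewrite -(dvdn_pcharf (pchar_Fp pp)) gtnNdvd // prime_gt0.
Qed.

(** Write the sums as n / d and n' / d'. Equality modulo p makes p divide n d' - n' d, which is
    nonzero because the real sums differ; moreover d d' <= (2b)^(2l). *)
Lemma recip_sum_sep b f f' :
  (forall i, prime (f i)) -> (forall i, prime (f' i)) ->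
  (forall i, (f i <= 2 * b)%N) -> (forall i, (f' i <= 2 * b)%N) ->
  recip_sum 'F_p f = recip_sum 'F_p f' -> recip_sum R f != recip_sum R f' ->
  p%:R <= `|recip_sum R f - recip_sum R f'| * (2 * b)%:R ^+ (2 * l).
Proof.
move=> pf pf' fb f'b.
have nz f0 i : prime (f0 i) -> (f0 i : nat)%:R != 0 :> R.
  by move=> p0; rewrite pnatr_eq0 -lt0n prime_gt0.
have pos f0 : (forall i, prime (f0 i)) -> (0 < \prod_i (f0 i : nat))%N.
  by move=> p0; apply: prodn_gt0 => i; rewrite prime_gt0.
rewrite !recip_sumE; try (by move=> i; rewrite ?Fp_ord_neq0 ?nz).
set n := recip_num f; set n' := recip_num f'.
set d := (\prod_i _)%N; set d' := (\prod_i _)%N.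
have d0 : (0 < d)%N by exact: pos.
have d'0 : (0 < d')%N by exact: pos.
have dF f0 : (forall i, prime (f0 i)) -> (\prod_i (f0 i : nat))%N%:R != 0 :> 'F_p.
  by move=> p0; rewrite natr_prod; apply/prodf_neq0 => i _; exact: Fp_ord_neq0.
move=> /eqP; rewrite eqr_div ?dF // -!natrM => /eqP e.
rewrite eqr_div ?pnatr_eq0 -?lt0n // -!natrM eqr_nat => ne.
have dist : (p <= `|(n * d')%:Z - (n' * d)%:Z|)%N.
  apply: dvdn_leq; first by rewrite absz_gt0 subr_eq0 eqz_nat.
  have [le|/ltnW le] := leqP (n' * d) (n * d').
    rewrite subzn // (dvdn_pcharf (pchar_Fp pp)) natrB // e subrr //.
  rewrite distnC subzn // (dvdn_pcharf (pchar_Fp pp)) natrB // e subrr //.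
have dd : ((d * d')%:R : R) <= (2 * b)%:R ^+ (2 * l).
  rewrite -natrX ler_nat [(2 * l)%N]mul2n -addnn expnD.
  have bd f0 : (forall i, (f0 i <= 2 * b)%N) -> (\prod_i (f0 i : nat) <= (2 * b) ^ l)%N.
    move=> h; rewrite -[X in (_ <= _ ^ X)%N](card_ord l) -prod_nat_const.
    exact: leq_prod.
  by rewrite leq_mul ?bd.
apply: le_trans (_ : `|(n%:R / d%:R - n'%:R / d'%:R) : R| * (d * d')%:R <= _); last first.
  by rewrite ler_wpM2l.
rewrite -[X in _ * X]normr_nat -normrM.
have -> : (n%:R / d%:R - n'%:R / d'%:R) * (d * d')%:R = ((n * d')%:Z - (n' * d)%:Z)%:~R :> R.
  rewrite intrB -!pmulrn !natrM; field.
  by rewrite !pnatr_eq0 -!lt0n d0 d'0.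
by rewrite -intr_norm -abszE -pmulrn ler_nat.
Qed.

Definition recip_count (B : {set 'I_p}) (a : 'F_p) : nat :=
  #|[set f : {ffun 'I_l -> 'I_p} | (f \in ffun_on (mem B)) && (recip_sum 'F_p f == a)]|.

(* The values of the real sum of reciprocals lie in [0, l / b] and are p / (2b)^(2l) apart. *)
Lemma recip_count_le b (B : {set 'I_p}) a : (0 < b)%N -> (l <= b)%N ->
  (forall x : 'I_p, x \in B -> prime x && (b < x <= 2 * b)%N) ->
  (recip_count B a)%:R <=
  l%:R ^+ l * (1 + l%:R / b%:R * (2 * b)%:R ^+ (2 * l) / p%:R) :> R.
Proof.
move=> b0 lb hB; set X := _ / b%:R * _ / _.
have X0 : 0 <= X by rewrite !divr_ge0 ?mulr_ge0 ?divr_ge0 ?exprn_ge0.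
have p0 : (0 : R) < p%:R by rewrite ltr0n prime_gt0.
have B0 : (0 : R) < (2 * b)%:R ^+ (2 * l) by rewrite exprn_gt0 // ltr0n; lia.
pose S := [set f : {ffun 'I_l -> 'I_p} | (f \in ffun_on (mem B)) && (recip_sum 'F_p f == a)].
have SP f : f \in S -> [/\ forall i, prime (f i), forall i, (b < f i <= 2 * b)%N
    & recip_sum 'F_p f = a].
  rewrite inE => /andP[/ffun_onP fB /eqP e]; split=> // i.
    by have /andP[] := hB _ (fB i).
  by have /andP[] := hB _ (fB i).
(* Bins of width p / (2b)^(2l): by [recip_sum_sep], tuples of [S] in one bin have the same real
   sum. *)
pose bin f := Num.trunc (recip_sum R f * (2 * b)%:R ^+ (2 * l) / p%:R).
have r0 f : 0 <= recip_sum R f by apply: sumr_ge0.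
have v0 f : 0 <= recip_sum R f * (2 * b)%:R ^+ (2 * l) / p%:R.
  by rewrite divr_ge0 ?mulr_ge0 ?r0 // ltW.
have binK f : f \in S -> (bin f < (Num.trunc X).+1)%N.
  move=> /SP[pf fb _]; rewrite ltnS; apply: le_truncn.
  rewrite ler_wpM2r ?invr_ge0 // ler_wpM2r ?(ltW B0) // /recip_sum.
  apply: le_trans (_ : \sum_(i < l) b%:R^-1 <= _).
    apply: ler_sum => i _; rewrite lef_pV2 ?posrE ?ltr0n ?b0 ?(prime_gt0 (pf i)) // ler_nat.
    by have := fb i; lia.
  by rewrite sumr_const card_ord mulr_natl.
have same f f' : f \in S -> f' \in S -> bin f = bin f' -> recip_sum R f = recip_sum R f'.
  move=> /SP[pf fb fa] /SP[pf' f'b f'a] ebin; apply/eqP; apply: contraT => ne.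
  have ub (g : {ffun 'I_l -> 'I_p}) : (forall i, (b < g i <= 2 * b)%N) -> forall i, (g i <= 2 * b)%N.
    by move=> h i; case/andP: (h i).
  have := recip_sum_sep pf pf' (ub _ fb) (ub _ f'b) (etrans fa (esym f'a)) ne.
  have /andP[a1 a2] := truncn_itv (v0 f); have /andP[b1 b2] := truncn_itv (v0 f').
  rewrite leNgt -ltr_pdivlMr // => /negP; case.
  rewrite ltr_norml.
  move: a1 a2 b1 b2; rewrite -/(bin f) -/(bin f') ebin.
  rewrite ler_pdivlMr // ltr_pdivrMr // ler_pdivlMr // ltr_pdivrMr //.
  rewrite -natr1 => a1 a2 b1 b2.
  rewrite -mulNr ltr_pdivrMr // ltr_pdivlMr // mulrBl; apply/andP; split; lra.
(* By [recip_sum_codom], the tuples of one bin take their entries among those of a fixed one, that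
   is, among at most l primes. *)
have fib (v : nat) : (#|[set f in S | bin f == v]| <= l ^ l)%N.
  have [->|[f]] := set_0Vmem [set f in S | bin f == v]; first by rewrite cards0.
  rewrite inE => /andP[fS /eqP fv].
  have sub : [set f in S | bin f == v] \subset ffun_on (mem (codom f)).
    apply/fintype.subsetP => g; rewrite inE => /andP[gS /eqP gv].
    have /SP[pf fb _] := fS; have /SP[pg gb _] := gS.
    apply/ffun_onP => i; apply: recip_sum_codom => // [j|].
      by apply: leq_ltn_trans lb _; case/andP: (gb j).
    by apply: same => //; rewrite fv.
  apply: leq_trans (subset_leq_card sub) _.
  rewrite card_ffun_on card_ord.
  have mono x y n : (x <= y)%N -> (x ^ n <= y ^ n)%N by case: n => // n; rewrite leq_exp2r.
  by apply: mono; apply: leq_trans (leq_image_card _ _) _; rewrite card_ord.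
have cS : (#|S| <= (Num.trunc X).+1 * l ^ l)%N.
  rewrite -sum1_card (partition_big (fun f => inord (bin f) : 'I_(Num.trunc X).+1) predT) //=.
  rewrite -[X in (_ <= X * _)%N]card_ord -sum_nat_const; apply: leq_sum => v _.
  apply: leq_trans (fib v); rewrite sum1_card; apply/subset_leq_card/fintype.subsetP => f.
  by rewrite unfold_in => /andP[fS /eqP <-]; rewrite inE fS inordK ?eqxx ?binK.
rewrite /recip_count -/S; apply: le_trans (_ : ((Num.trunc X).+1 * l ^ l)%:R <= _).
  by rewrite ler_nat.
rewrite natrM natrX mulrC ler_wpM2l ?exprn_ge0 // -natr1 addrC lerD2l.
by have /andP[] := truncn_itv X0.
Qed.

End Reciprocals.

(** * Bilinear sums over reciprocals, by Hoelder and Parseval *)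

Section Phase.
Variable R : realType.
Local Notation nc := (@Normc.normc R).
Implicit Types z : R[i].

Lemma normc_conj z : nc (z^*)%C = nc z.
Proof. by case: z => a b /=; rewrite sqrrN. Qed.

Lemma normc_sqr z : ((nc z ^+ 2)%:C)%C = z * (z^*)%C.
Proof.
by rewrite -sqr_normc normc_def /= -rmorphXn /=; case: z.
Qed.

(** For z nonzero, w is the conjugate of z divided by its modulus. The bound on w is an inequality
    so that w = 0 can serve for z = 0. *)
Lemma phase_ex z : exists2 w, nc w <= 1 & w * z = (nc z)%:C%C.
Proof.
have [->|z0] := eqVneq z 0.
  by exists 0; rewrite ?Normc.normc0 ?mul0r.
have n0 : nc z != 0 by apply: contra_neq z0 => /Normc.eq0_normc.
exists ((z^*)%C * ((nc z)^-1)%:C%C).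
  by rewrite Normc.normcM normc_conj normc_real ger0_norm ?invr_ge0 ?normc_ge0 // divff.
rewrite mulrAC [_ * z]mulrC -normc_sqr -rmorphM /=.
by rewrite expr2 mulfK.
Qed.

End Phase.

Section Bilinear.
Variables (R : realType) (p : nat) (psi : 'F_p -> R[i]).
Local Notation nc := (@Normc.normc R).
Hypothesis pp : prime p.
Hypothesis psiD : forall x y, psi (x + y) = psi x * psi y.
Hypothesis psi_norm : forall x, nc (psi x) = 1.
Hypothesis psi_neq1 : exists x, psi x != 1.

Lemma psi_neq0 x : psi x != 0.
Proof.
apply/eqP => e; have := psi_norm x; rewrite e Normc.normc0 => /eqP.
by rewrite eq_sym oner_eq0.
Qed.

Lemma psi0 : psi 0 = 1.
Proof. by apply: (mulfI (psi_neq0 0)); rewrite -psiD addr0 mulr1. Qed.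

Lemma psiN x : psi (- x) = ((psi x)^*)%C.
Proof.
apply: (mulfI (psi_neq0 x)); rewrite -psiD subrr psi0 -normc_sqr psi_norm.
by rewrite expr1n.
Qed.

Lemma psi_sum (I : Type) (s : seq I) (P : pred I) (F : I -> 'F_p) :
  psi (\sum_(i <- s | P i) F i) = \prod_(i <- s | P i) psi (F i).
Proof. exact: (big_morph psi psiD psi0). Qed.

(** Orthogonality: translation by an x with psi x different from 1 preserves the full sum and
    multiplies it by psi x. *)
Lemma sum_psi c : \sum_a psi (a * c) = if c == 0 then p%:R else 0.
Proof.
case: eqVneq => [->|c0].
  under eq_bigr do rewrite mulr0 psi0.
  by rewrite sumr_const card_Fp.
rewrite -(reindex_inj (mulIf c0) (P := predT) (F := psi)).
have [x px] := psi_neq1; apply: (mulfI (_ : 1 - psi x != 0)).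
  by rewrite subr_eq0 eq_sym.
rewrite mulr0 mulrBl mul1r mulr_sumr.
rewrite [X in X - _](reindex_inj (addrI x)) /=.
by under eq_bigr do rewrite psiD; rewrite subrr.
Qed.

Lemma parseval (K : 'F_p -> R[i]) :
  \sum_a nc (\sum_u K u * psi (a * u)) ^+ 2 = p%:R * \sum_u nc (K u) ^+ 2.
Proof.
apply: complexI; rewrite rmorph_sum rmorphM rmorph_sum rmorph_nat /=.
under eq_bigr => a _.
  rewrite normc_sqr rmorph_sum /= big_distrlr /=.
  under eq_bigr => u _ do under eq_bigr => v _ do
    rewrite rmorphM /= -psiN mulrACA -psiD -mulrN -mulrDr.
  over.
rewrite exchange_big mulr_sumr; apply: eq_bigr => u _ /=.
rewrite exchange_big /=.
under eq_bigr => v _ do rewrite -mulr_sumr sum_psi.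
rewrite (bigD1 u) //= subrr eqxx big1 ?addr0 => [|v vu].
  by rewrite normc_sqr mulrC.
by rewrite subr_eq0 eq_sym (negbTE vu) mulr0.
Qed.

(** The coefficient of psi (c u) when the k-th power of the sum over x in A of w x psi (c / x) is
    expanded; see [recip_expand]. *)
Definition recip_coef k (A : {set 'I_p}) (w : 'I_p -> R[i]) (u : 'F_p) : R[i] :=
  \sum_(f : {ffun 'I_k -> 'I_p} | (f \in ffun_on (mem A)) && (recip_sum 'F_p f == u))
     \prod_i w (f i).

Lemma recip_coef_le k A w u : (forall x, nc (w x) <= 1) ->
  nc (recip_coef k A w u) <= (recip_count k A u)%:R.
Proof.
move=> w1; apply: le_trans (normc_sum _ _ _) _.
apply: le_trans (ler_sum (G := fun=> 1) _ _) _ => [f _|]; first exact: normc_prod_le1.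
by rewrite /recip_count cardsE sumr_const.
Qed.

Lemma sum_recip_count k (A : {set 'I_p}) : (\sum_u recip_count k A u = #|A| ^ k)%N.
Proof.
have := card_ffun_on 'I_k (mem A); rewrite card_ord => <-.
rewrite -sum1_card (partition_big (@recip_sum p k 'F_p) predT) //=.
by apply: eq_bigr => u _; rewrite /recip_count cardsE sum1_card.
Qed.

Lemma recip_expand k (A : {set 'I_p}) w c :
  (\sum_(x in A) w x * psi (c * (x : nat)%:R^-1)) ^+ k =
  \sum_u recip_coef k A w u * psi (c * u).
Proof.
rewrite -[k in LHS]card_ord -prodr_const bigA_distr_big /=.
rewrite (partition_big (@recip_sum p k 'F_p) predT) //=.
apply: eq_bigr => u _; rewrite mulr_suml; apply: eq_bigr => f /andP[_ /eqP <-].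
by rewrite big_split /= /recip_sum mulr_sumr psi_sum.
Qed.

(** Hoelder over x raises the inner sum to the power l + 1, which expands into characters psi (a /
    x) with coefficients bounded by the counts of B. After exchanging x and a, Hoelder over a with
    exponent 2k + 2 leaves the sum of the |U a|^(2k+2), to which Parseval applies. *)
Lemma bilinear_power k l (A B : {set 'I_p}) (beta : 'I_p -> R[i]) (IA IB : R) :
  (forall y, nc (beta y) <= 1) ->
  (forall u, (recip_count k.+1 A u)%:R <= IA) ->
  (forall u, (recip_count l.+1 B u)%:R <= IB) ->
  (\sum_(x in A) nc (\sum_(y in B) beta y * psi ((x : nat)%:R^-1 * (y : nat)%:R^-1)))
     ^+ (l.+1 * (2 * k).+2) <=
  #|A|%:R ^+ (l * (2 * k).+2) * #|B|%:R ^+ (l.+1 * (2 * k).+1) *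
  (IB * (p%:R * (IA * #|A|%:R ^+ k.+1))).
Proof.
move=> b1 hA hB.
set V := fun x : 'I_p => \sum_(y in B) beta y * psi ((x : nat)%:R^-1 * (y : nat)%:R^-1).
(* The phases w turn the sum of moduli into the modulus of a linear expression, in which x and a can
   be exchanged. *)
have [w w1 wV] : exists2 w : 'I_p -> R[i], forall x, nc (w x) <= 1
    & forall x, w x * V x ^+ l.+1 = (nc (V x) ^+ l.+1)%:C%C.
  have [w hw] := choice (fun x => let: ex_intro2 w a b := phase_ex (V x ^+ l.+1)
    in ex_intro (fun w => nc w <= 1 /\ w * V x ^+ l.+1 = (nc (V x ^+ l.+1))%:C%C) w (conj a b)).
  by exists w => x; have [a b] := hw x; rewrite // b normcX.
pose U a := \sum_(x in A) w x * psi (a * (x : nat)%:R^-1).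
have hS : \sum_(x in A) nc (V x) ^+ l.+1 <= \sum_a (recip_count l.+1 B a)%:R * nc (U a).
  apply: le_trans (_ : nc (\sum_(x in A) w x * V x ^+ l.+1) <= _).
    under [in leRHS]eq_bigr do rewrite wV.
    by rewrite -rmorph_sum normc_real ler_norm.
  under eq_bigr => x _ do rewrite recip_expand mulr_sumr.
  rewrite exchange_big /=; apply: le_trans (normc_sum _ _ _) _.
  apply: ler_sum => a _.
  have -> : \sum_(x in A) w x * (recip_coef l.+1 B beta a * psi ((x : nat)%:R^-1 * a)) =
      recip_coef l.+1 B beta a * U a.
    by rewrite mulr_sumr; apply: eq_bigr => x _; rewrite mulrCA [_^-1 * a]mulrC.
  by rewrite Normc.normcM ler_wpM2r ?normc_ge0 ?recip_coef_le.
(* Parseval for the (k+1)-th power of U. The squares of the counts of A sum to at most IA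
   |A|^(k+1). *)
have hU : \sum_a nc (U a) ^+ (2 * k).+2 <= p%:R * (IA * #|A|%:R ^+ k.+1).
  have -> : \sum_a nc (U a) ^+ (2 * k).+2 = p%:R * \sum_u nc (recip_coef k.+1 A w u) ^+ 2.
    rewrite -parseval; apply: eq_bigr => a _.
    by rewrite -recip_expand normcX -exprM; congr (_ ^+ _); lia.
  rewrite ler_wpM2l // -natrX -sum_recip_count natr_sum mulr_sumr.
  apply: ler_sum => u _; rewrite expr2.
  apply: le_trans (_ : (recip_count k.+1 A u)%:R * (recip_count k.+1 A u)%:R <= _).
    by rewrite ler_pM ?normc_ge0 ?recip_coef_le.
  by rewrite ler_wpM2r.
have IB0 : 0 <= IB by apply: le_trans (hB 0).
rewrite exprM; apply: le_trans (_ : (#|A|%:R ^+ l * \sum_(x in A) nc (V x) ^+ l.+1) ^+ (2 * k).+2 <= _).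
  rewrite lerXn2r ?nnegrE ?exprn_ge0 ?mulr_ge0 ?sumr_ge0 // => [x _|x _|];
    rewrite ?normc_ge0 ?exprn_ge0 ?normc_ge0 //.
  have := @power_mean R 'I_p (fun x => x \in A) (fun=> 1) (fun x => nc (V x)) l.
  rewrite sumr_const; under eq_bigr do rewrite mul1r.
  by under [X in _ -> _ -> _ <= _ * X]eq_bigr do rewrite mul1r; apply => // x _; exact: normc_ge0.
rewrite exprMn -exprM -!mulrA ler_wpM2l ?exprn_ge0 //.
apply: le_trans (_ : (\sum_a (recip_count l.+1 B a)%:R * nc (U a)) ^+ (2 * k).+2 <= _).
  by rewrite lerXn2r ?nnegrE ?sumr_ge0 // => x _; rewrite ?mulr_ge0 ?exprn_ge0 ?normc_ge0.
apply: le_trans (power_mean _ _ _) _ => [a _|a _|]; rewrite ?normc_ge0 //.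
rewrite -natr_sum sum_recip_count natrX -exprM ler_wpM2l ?exprn_ge0 //.
apply: le_trans (_ : IB * \sum_a nc (U a) ^+ (2 * k).+2 <= _); last by rewrite ler_wpM2l.
by rewrite mulr_sumr; apply: ler_sum => a _; rewrite ler_wpM2r ?exprn_ge0 ?normc_ge0.
Qed.

End Bilinear.

(** * The saving in a dyadic box of primes *)

Section BilinearBox.
Variables (R : realType) (p : nat) (psi : 'F_p -> R[i]).
Local Notation nc := (@Normc.normc R).
Hypothesis pp : prime p.
Hypothesis psiD : forall x y, psi (x + y) = psi x * psi y.
Hypothesis psi_norm : forall x, nc (psi x) = 1.
Hypothesis psi_neq1 : exists x, psi x != 1.

(** Here s is sqrt p, a is 2^i or 2^j, and the factor of g s is the bound of [recip_count_le] for k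
    + 1 summands. Its two terms are balanced when s lies between a^k and a^(k+1), and g measures the
    room left on both sides. *)
Lemma count_bound_side (k : nat) (a g s : R) : 1 <= a -> 0 < s -> 0 <= g ->
  s * g <= a ^+ k.+1 -> a ^+ k * g <= s ->
  g * (s * (k.+1%:R ^+ k.+1 *
    (1 + k.+1%:R / a * (2 * a) ^+ (2 * k.+1) / s ^+ 2))) <=
  (8 * k.+1%:R) ^+ k.+1 * a ^+ k.+1.
Proof.
move=> a1 s0 g0 h1 h2; have a0 : 0 < a by apply: lt_le_trans a1.
have K0 : (0 : R) <= k.+1%:R by [].
have -> : g * (s * (k.+1%:R ^+ k.+1 *
    (1 + k.+1%:R / a * (2 * a) ^+ (2 * k.+1) / s ^+ 2))) =
  k.+1%:R ^+ k.+1 * (s * g + k.+1%:R * 4 ^+ k.+1 * a ^+ k.+1 * (a ^+ k * g / s)).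
  have -> : (2 * a) ^+ (2 * k.+1) = 4 ^+ k.+1 * a ^+ k.+1 * (a ^+ k * a).
    have e4 : 4 ^+ k.+1 = 2 ^+ k.+1 * 2 ^+ k.+1 :> R.
      by rewrite -exprMn; congr (_ ^+ _); ring.
    by rewrite exprM exprMn -exprSr exprMn e4; ring.
  by field; rewrite !gt_eqF.
have q1 : a ^+ k * g / s <= 1 by rewrite ler_pdivrMr // mul1r.
have A0 : 0 < a ^+ k.+1 by rewrite exprn_gt0.
have k8 : 1 + k.+1%:R * 4 ^+ k.+1 <= 8 ^+ k.+1 :> R.
  rewrite -!natrX -natrM -[X in X + _]/(1%:R) -natrD ler_nat.
  rewrite (_ : 8 = 2 * 4)%N // expnMn.
  have h : (k.+1 < 2 ^ k.+1)%N by rewrite ltn_expl.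
  apply: leq_trans (leq_mul h (leqnn _)).
  by rewrite mulSn leq_add2r expn_gt0.
rewrite [8 * _]mulrC exprMn -[leRHS]mulrA ler_wpM2l ?exprn_ge0 //.
apply: le_trans (ler_wpM2r (ltW A0) k8); rewrite mulrDl mul1r lerD //.
by rewrite ler_piMr // !mulr_ge0 ?exprn_ge0 // ltW.
Qed.

Lemma card_box i (A : {set 'I_p}) :
  (forall x : 'I_p, x \in A -> prime x && (2 ^ i < x <= 2 * 2 ^ i)%N) ->
  (#|A| <= 2 ^ i)%N.
Proof.
move=> hA; rewrite cardE -(size_map val).
apply: leq_trans (_ : size (iota (2 ^ i).+1 (2 ^ i)) <= _)%N; last by rewrite size_iota.
apply: uniq_leq_size; first by rewrite map_inj_uniq ?enum_uniq //; exact: val_inj.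
move=> _ /mapP[x + ->]; rewrite mem_enum => /hA /andP[_].
by rewrite mem_iota /=; lia.
Qed.

(** [bilinear_power] with k + 1 and l + 1 summands, the least numbers such that 2 i (k + 1) and 2 j
    (l + 1) exceed Q. The gain over the trivial bound 2^i 2^j is 2^(5t), more than Q^5. *)
Lemma bilinear_box (i j t : nat) (A B : {set 'I_p}) (beta : 'I_p -> R[i]) :
  let Q := trunc_log 2 p in
  let rho := (14 * (Q %/ (2 * i)).+1 * t)%N in
  let l := (Q %/ (2 * j))%N in
  (3 <= t)%N -> (Q < 2 ^ t)%N -> (t <= i)%N -> (t <= j)%N ->
  (Q.+1 + 2 * l.+1 * rho <= 2 * j * l.+1)%N ->
  (2 * j * l + 2 * l.+1 * rho <= Q)%N ->
  (forall x : 'I_p, x \in A -> prime x && (2 ^ i < x <= 2 * 2 ^ i)%N) ->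
  (forall x : 'I_p, x \in B -> prime x && (2 ^ j < x <= 2 * 2 ^ j)%N) ->
  (forall y, nc (beta y) <= 1) ->
  \sum_(x in A) nc (\sum_(y in B) beta y * psi ((x : nat)%:R^-1 * (y : nat)%:R^-1)) <=
  (2 ^ i)%:R * (2 ^ j)%:R / (2 ^ (5 * t))%:R.
Proof.
move=> Q rho l t3 Qt ti tj g1 g2 hA hB b1; set k := (Q %/ (2 * i))%N in rho g1 g2.
have i0 : (0 < i)%N by lia.
have j0 : (0 < j)%N by lia.
have /andP[pQ Qp] := trunc_log_bounds (isT : 1 < 2)%N (prime_gt0 pp).
rewrite -/Q in pQ Qp.
have kQ : (2 * i * k <= Q)%N by rewrite mulnC leq_trunc_div.
have Qk : (Q.+1 <= 2 * i * k.+1)%N by rewrite mulnC ltn_ceil //; lia.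
have k2t : (k.+1 <= 2 ^ t)%N by apply: leq_ltn_trans Qt; apply: leq_trans kQ; rewrite leq_pmull //; lia.
have l2t : (l.+1 <= 2 ^ t)%N by apply: leq_ltn_trans Qt; exact: leq_div.
pose s : R := Num.sqrt p%:R.
have p0 : (0 : R) < p%:R by rewrite ltr0n prime_gt0.
have s0 : 0 < s by rewrite sqrtr_gt0.
have sE : s ^+ 2 = p%:R by rewrite sqr_sqrtr // ltW.
(* Only 2^Q <= p < 2^(Q+1) is used to compare powers of 2 with sqrt p; hence Q in one condition and
   Q + 1 in the other. *)
have le_s (m : nat) : (2 * m <= Q)%N -> ((2 ^ m)%:R : R) <= s.
  move=> h; rewrite -(@ler_pXn2r _ 2) ?nnegrE ?(ltW s0) // sE -natrX ler_nat.
  by rewrite -expnM; apply: leq_trans pQ; rewrite leq_exp2l //; lia.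
have ge_s (m : nat) : (Q.+1 <= 2 * m)%N -> s <= ((2 ^ m)%:R : R).
  move=> h; rewrite -(@ler_pXn2r _ 2) ?nnegrE ?(ltW s0) // sE -natrX ler_nat.
  by rewrite -expnM; apply: ltnW; apply: leq_trans Qp _; rewrite leq_exp2l //; lia.
pose a : R := (2 ^ i)%:R; pose b : R := (2 ^ j)%:R.
have a1 : 1 <= a by rewrite ler1n expn_gt0.
have b1' : 1 <= b by rewrite ler1n expn_gt0.
pose g : R := (2 ^ (l.+1 * rho))%:R.
have g0 : 0 < g by rewrite ltr0n expn_gt0.
pose IA : R := k.+1%:R ^+ k.+1 * (1 + k.+1%:R / a * (2 * a) ^+ (2 * k.+1) / p%:R).
pose IB : R := l.+1%:R ^+ l.+1 * (1 + l.+1%:R / b * (2 * b) ^+ (2 * l.+1) / p%:R).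
have IA0 : 0 <= IA.
  by rewrite mulr_ge0 ?exprn_ge0 ?addr_ge0 ?mulr_ge0 ?invr_ge0 ?exprn_ge0 ?mulr_ge0 // ltW.
have IB0 : 0 <= IB.
  by rewrite mulr_ge0 ?exprn_ge0 ?addr_ge0 ?mulr_ge0 ?invr_ge0 ?exprn_ge0 ?mulr_ge0 // ltW.
(* For A the choice of k gives 2^(ik) <= sqrt p <= 2^(i(k+1)), so that g = 1 is admissible. *)
have eA : s * IA <= (8 * k.+1%:R) ^+ k.+1 * a ^+ k.+1.
  have := @count_bound_side k a 1 s a1 s0 ler01; rewrite sE !mulr1 mul1r; apply.
    by rewrite /a -natrX -expnM ge_s // mulnA.
  by rewrite /a -natrX -expnM le_s // mulnA.
have g1' : (Q.+1 + 2 * (l.+1 * rho) <= 2 * (j * l.+1))%N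
  by rewrite [(2 * (j * _))%N]mulnA [(2 * (l.+1 * _))%N]mulnA.
have g2' : (2 * (j * l) + 2 * (l.+1 * rho) <= Q)%N
  by rewrite [(2 * (j * _))%N]mulnA [(2 * (l.+1 * _))%N]mulnA.
(* Through [ge_s] and [le_s], [g1] gives s g <= b^(l+1) and [g2] gives b^l g <= s. The whole gain
   comes from B. *)
have eB : g * (s * IB) <= (8 * l.+1%:R) ^+ l.+1 * b ^+ l.+1.
  have := @count_bound_side l b g s b1' s0 (ltW g0); rewrite sE; apply.
    apply: le_trans (_ : (2 ^ (j * l.+1 - l.+1 * rho))%:R * g <= _).
      rewrite ler_wpM2r ?(ltW g0) // ge_s //; move: g1'; clear; move: (j * _)%N (_ * rho)%N => u v; lia.
    rewrite /b -natrX -expnM -natrM -expnD ler_nat leq_exp2l // subnK //; move: g1'; clear.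
    by move: (j * _)%N (_ * rho)%N => u v; lia.
  by rewrite /b -natrX -expnM -natrM -expnD le_s // mulnDr.
have cA := card_box hA; have cB := card_box hB.
have cntA u : (recip_count k.+1 A u)%:R <= IA.
  have := @recip_count_le p k.+1 R pp (2 ^ i) A u; rewrite /IA /a natrM; apply => //.
    by rewrite expn_gt0.
  by apply: leq_trans k2t _; rewrite leq_exp2l.
have cntB u : (recip_count l.+1 B u)%:R <= IB.
  have := @recip_count_le p l.+1 R pp (2 ^ j) B u; rewrite /IB /b natrM; apply => //.
    by rewrite expn_gt0.
  by apply: leq_trans l2t _; rewrite leq_exp2l.
clearbody IA IB.
have := bilinear_power pp psiD psi_norm psi_neq1 b1 cntA cntB.
set S := \sum_(x in A) _ => hS.
have S0 : 0 <= S by apply: sumr_ge0 => x _; exact: normc_ge0.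
have T0 : (0 : R) < (2 ^ t)%:R by rewrite ltr0n expn_gt0.
rewrite -(@ler_pXn2r _ (l.+1 * (2 * k).+2)) ?nnegrE ?divr_ge0 ?mulr_ge0 //.
apply: le_trans hS _.
apply: le_trans (_ : a ^+ (l * (2 * k).+2) * b ^+ (l.+1 * (2 * k).+1) *
    (IB * (p%:R * (IA * a ^+ k.+1))) <= _).
  apply: ler_pM; rewrite ?mulr_ge0 ?exprn_ge0 //.
    by apply: ler_pM; rewrite ?exprn_ge0 // lerXn2r ?nnegrE // ler_nat.
  rewrite ler_wpM2l // ler_wpM2l ?(ltW p0) // ler_wpM2l //.
  by rewrite lerXn2r ?nnegrE // ler_nat.
(* Everything is measured in powers of W: g is W^14, and since 8 (k + 1) and 8 (l + 1) are at most
   2^(2t), each of the two losses is at most W^2. *)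
pose W : R := (2 ^ t)%:R ^+ (k.+1 * l.+1).
have W0 : 0 < W by rewrite exprn_gt0.
have gE : g = W ^+ 14.
  have e : (l.+1 * rho = t * (k.+1 * l.+1 * 14))%N by rewrite /rho; ring.
  by rewrite /g /W e expnM natrX exprM.
have small n m : (n.+1 <= 2 ^ t)%N -> (8 * n.+1%:R) ^+ n.+1 <= (2 ^ t)%:R ^+ (n.+1 * m.+1) ^+ 2 :> R.
  move=> nt; apply: le_trans (_ : (2 ^ t * 2 ^ t)%:R ^+ n.+1 <= _).
    rewrite -natrM lerXn2r ?nnegrE // ler_nat leq_mul //.
    by rewrite (_ : 8 = 2 ^ 3)%N // leq_exp2l.
  by rewrite natrM -expr2 -!exprM ler_weXn2l ?ler1n ?expn_gt0 // mulnC leq_mul2r leq_pmulr.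
have eA' : s * IA <= W ^+ 2 * a ^+ k.+1.
  apply: le_trans eA _; rewrite ler_wpM2r ?exprn_ge0 ?(le_trans ler01) //.
  exact: small.
have eB' : g * (s * IB) <= W ^+ 2 * b ^+ l.+1.
  apply: le_trans eB _; rewrite ler_wpM2r ?exprn_ge0 ?(le_trans ler01) //.
  by rewrite /W mulnC; exact: small.
have a0 : 0 < a by apply: lt_le_trans a1.
have b0 : 0 < b by apply: lt_le_trans b1'.
(* 14 - 2 - 2 = 10 powers of W remain, and W^10 is the power of 2^(5t) with exponent (l + 1)(2k +
   2). *)
have key : IB * (p%:R * IA) * W ^+ 10 <= a ^+ k.+1 * b ^+ l.+1.
  have W4 : 0 < W ^+ 4 by rewrite exprn_gt0.
  rewrite -(ler_pM2l W4).
  have -> : W ^+ 4 * (IB * (p%:R * IA) * W ^+ 10) = (s * IA) * (g * (s * IB)).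
    by rewrite gE -sE; ring.
  have -> : W ^+ 4 * (a ^+ k.+1 * b ^+ l.+1) = (W ^+ 2 * a ^+ k.+1) * (W ^+ 2 * b ^+ l.+1).
    by ring.
  by rewrite ler_pM ?mulr_ge0 ?(ltW s0) ?(ltW g0).
have E1 : (2 ^ (5 * t))%:R ^+ (l.+1 * (2 * k).+2) = W ^+ 10 :> R.
  have e : (5 * t * (l.+1 * (2 * k).+2) = t * (k.+1 * l.+1 * 10))%N by ring.
  by rewrite /W -exprM -!natrX -!expnM e.
rewrite expr_div_n E1 ler_pdivlMr ?exprn_gt0 // -/a -/b exprMn.
have ea : (l.+1 * (2 * k).+2 = l * (2 * k).+2 + (k.+1 + k.+1))%N by ring.
have eb : (l.+1 * (2 * k).+2 = l.+1 * (2 * k).+1 + l.+1)%N by ring.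
rewrite {1}ea eb [a ^+ (_ + (_ + _))]exprD [a ^+ (k.+1 + _)]exprD [b ^+ (_ * _ + _)]exprD.
set x := a ^+ (l * _); set y := b ^+ (l.+1 * _).
have -> : x * y * (IB * (p%:R * (IA * a ^+ k.+1))) * W ^+ 10 =
   (x * y * a ^+ k.+1) * (IB * (p%:R * IA) * W ^+ 10) by ring.
have -> : x * (a ^+ k.+1 * a ^+ k.+1) * (y * b ^+ l.+1) =
   (x * y * a ^+ k.+1) * (a ^+ k.+1 * b ^+ l.+1) by ring.
by rewrite ler_wpM2l // !mulr_ge0 ?exprn_ge0 ?ltW.
Qed.

End BilinearBox.

(** * Good levels, and the number of bad ones *)

(* With l = Q / (2j) + 1 and Q = log_2 p, goodness amounts to sqrt p * 2^(l gap) <= 2^(jl) and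
   2^(j(l-1)) * 2^(l gap) <= sqrt p: j keeps a distance gap from the points Q / (2l), at which the
   bilinear estimate gains nothing. The factor 14 leaves a saving of 2^(5t) after the losses
   (8k)^k (8l)^l <= 2^(4tkl). *)
Definition gap Q t i : nat := (14 * (Q %/ (2 * i)).+1 * t)%N.

Definition good Q t i j : bool :=
  let l := (Q %/ (2 * j))%N in
  [&& (t <= j)%N, (Q.+1 + 2 * l.+1 * gap Q t i <= 2 * j * l.+1)%N
    & (2 * j * l + 2 * l.+1 * gap Q t i <= Q)%N].

Lemma card_spread n (A : {set 'I_n}) d :
  (forall x y : 'I_n, x \in A -> y \in A -> (x <= y)%N -> (y < x + d)%N) -> (#|A| <= d)%N.
Proof.
move=> h; have [->|[x0 x0A]] := set_0Vmem A; first by rewrite cards0.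
case: (arg_minnP (fun i : 'I_n => i : nat) x0A) => m mA mmin.
rewrite cardE -(size_map val); apply: leq_trans (_ : size (iota m d) <= _)%N.
  apply: uniq_leq_size; first by rewrite map_inj_uniq ?enum_uniq //; exact: val_inj.
  move=> _ /mapP[x + ->]; rewrite mem_enum => xA.
  by rewrite mem_iota mmin //= h ?mmin.
by rewrite size_iota.
Qed.

(** The j < v are counted trivially. For j >= v, l = Q / (2j) takes at most Q / (2v) + 1 values, and
    on the interval of the j with a given l, a bad j is near one of the ends: within a window of
    length gap at the lower end, or 2 gap at the upper one. *)
Lemma bad_count Q t i n v : (t <= v)%N -> (0 < v)%N -> (2 * gap Q t i <= Q)%N ->
  (#|[set j : 'I_n | ~~ good Q t i j]| <= v + (Q %/ (2 * v)).+1 * (3 * gap Q t i))%N.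
Proof.
move=> tv v0 rQ; set rho := gap Q t i in rQ *; set S := [set j | _].
rewrite -(cardsID [set j : 'I_n | (j < v)%N] S) leq_add //.
  apply: card_spread => x y; rewrite !inE => /andP[_ xv] /andP[_ yv] xy.
  by rewrite ltn_addl.
set S' := S :\: _; pose L := (Q %/ (2 * v)).+1.
have S'P j : j \in S' -> [/\ (v <= j)%N, (Q %/ (2 * j) < L)%N & ~~ good Q t i j].
  rewrite !inE -leqNgt => /andP[vj ->]; split=> //.
  by rewrite ltnS leq_div2l // ?muln_gt0 ?leq_mul2l.
rewrite -sum1_card (partition_big (fun j : 'I_n => inord (Q %/ (2 * j)) : 'I_L) predT) //=.
rewrite -/L -[L in X in (_ <= X)%N]card_ord -sum_nat_const; apply: leq_sum => l _.
rewrite sum1_card.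
pose A1 := [set j : 'I_n | [&& (v <= j)%N, (Q %/ (2 * j) == l)%N &
  (2 * (j * l.+1) < Q.+1 + 2 * (l.+1 * rho))%N]].
pose A2 := [set j : 'I_n | [&& (v <= j)%N, (Q %/ (2 * j) == l)%N &
  (Q < 2 * (j * l) + 2 * (l.+1 * rho))%N]].
have sub : [pred j | (j \in S') && (inord (Q %/ (2 * j)) == l :> 'I_L)] \subset A1 :|: A2.
  apply/fintype.subsetP => j; rewrite inE => /andP[/S'P[vj jL bj] /eqP el].
  have {}el : (Q %/ (2 * j) = l)%N by rewrite -el inordK.
  rewrite !inE vj el eqxx /=; move: bj; rewrite /good el (leq_trans tv vj) /= -/rho.
  by rewrite negb_and -!ltnNge !mulnA.
apply: leq_trans (subset_leq_card sub) _; apply: leq_trans (leq_card_setU _ _) _.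
rewrite (_ : 3 * rho = rho + 2 * rho)%N; last by lia.
have floor (j : 'I_n) : (v <= j)%N -> (Q %/ (2 * j) == l)%N ->
    (2 * (j * l) <= Q < 2 * (j * l.+1))%N.
  move=> vj /eqP <-; rewrite !mulnA ![(2 * j * _)%N]mulnC leq_trunc_div ltn_ceil //.
  by lia.
apply: leq_add; apply: card_spread => x y; rewrite !inE.
  move=> /and3P[vx lx _] /and3P[vy ly hy] _.
  have /andP[_ hx] := floor x vx lx; rewrite -(@ltn_pmul2r l.+1) // mulnDl [(rho * _)%N]mulnC.
  move: hx hy; clear; move: (y * _)%N (x * _)%N (_ * rho)%N => a b c; lia.
move=> /and3P[vx lx hx] /and3P[vy ly _] _.
have /andP[hy _] := floor y vy ly.
(* For l = 0 the failing condition reads Q < 2 gap, against the hypothesis. *)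
have [l0|l0] := posnP l; first by move: hx rQ; rewrite l0; lia.
rewrite -(@ltn_pmul2r l) // mulnDl.
have : (l.+1 * rho <= 2 * rho * l)%N by rewrite -mulnA [(rho * l)%N]mulnC mulnA leq_mul2r; lia.
by move: hx hy; clear; move: (y * _)%N (x * _)%N (_ * rho)%N (_ * rho * _)%N => a b c d; lia.
Qed.

(** * Real estimates for the count of bad levels and for the sum over the levels *)

Section SumEstimates.
Variable R : realType.

(** The threshold v of [bad_count] is taken just above y = Q t / sqrt i. As i <= Q, the gap is at
    most 21 Q t / i, and then both terms of [bad_count] are O(y). *)
Lemma bad_count_le Q t i n : (0 < t)%N -> (0 < i <= Q)%N -> (2 * gap Q t i <= Q)%N ->
  #|[set j : 'I_n | ~~ good Q t i j]|%:R <= 100 * (Q%:R * t%:R / Num.sqrt i%:R) :> R.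
Proof.
move=> t0 /andP[i0 iQ] rQ; set x : R := Num.sqrt i%:R.
have xE : x ^+ 2 = i%:R by rewrite sqr_sqrtr.
have x1 : 1 <= x by rewrite -(@ler_pXn2r _ 2) ?nnegrE ?sqrtr_ge0 // xE expr1n ler1n.
have x0 : 0 < x by apply: lt_le_trans x1.
have xQ : x <= Q%:R.
  apply: le_trans (_ : i%:R <= _); last by rewrite ler_nat.
  by rewrite -xE expr2 ler_peMl // ltW.
have t1 : (1 : R) <= t%:R by rewrite ler1n.
set y : R := Q%:R * t%:R / x.
have ty : t%:R <= y by rewrite ler_pdivlMr // mulrC ler_wpM2r.
have y0 : 0 < y by apply: lt_le_trans ty; apply: lt_le_trans t1.
pose v := (Num.trunc y).+1.
have yv : y < v%:R by exact: truncnS_gt.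
have vy : v%:R <= y + 1.
  by rewrite -natr1 lerD2r truncn_le ltW.
have tv : (t <= v)%N by rewrite -(ler_nat R) (le_trans ty) // ltW.
have := @bad_count Q t i n v tv (ltn0Sn _) rQ.
rewrite -(ler_nat R) => /le_trans; apply.
have i0R : (0 : R) < i%:R by rewrite ltr0n.
have divR (m d : nat) : (0 < d)%N -> (m %/ d)%:R <= m%:R / d%:R :> R.
  by move=> d0; rewrite ler_pdivlMr ?ltr0n // -natrM ler_nat leq_trunc_div.
have rho_le : (gap Q t i)%:R <= 21 * (y / x).
  rewrite /gap !natrM.
  apply: le_trans (_ : 14 * (3 / 2 * (Q%:R / i%:R)) * t%:R <= _).
    rewrite ler_wpM2r // ler_wpM2l //.
    have := divR Q (2 * i)%N; rewrite muln_gt0 i0 => /(_ isT).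
    have : 1 <= Q%:R / i%:R :> R by rewrite ler_pdivlMr // mul1r ler_nat.
    rewrite -natr1 natrM invfM mulrCA => a b.
    by move: a b; set z := Q%:R / _; lra.
  rewrite le_eqVlt; apply/orP; left; apply/eqP; rewrite /y -xE; field.
  by rewrite gt_eqF.
have vinv : (Q %/ (2 * v)).+1%:R <= x / 2 + 1.
  rewrite -natr1 lerD2r; apply: le_trans (divR _ _ _) _ => //.
  rewrite natrM ler_pdivrMr; last by rewrite mulr_gt0 // ltr0n.
  rewrite (_ : x / 2 * (2 * v%:R) = x * v%:R); last by field.
  apply: le_trans (_ : x * y <= _); last by rewrite ler_wpM2l ?ltW.
  by rewrite /y mulrCA divff ?gt_eqF // mulr1 ler_peMr.
rewrite natrD natrM natrM.
apply: le_trans (_ : (y + 1) + (x / 2 + 1) * (3 * (21 * (y / x))) <= _).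
  by rewrite lerD // ler_pM // ler_wpM2l.
have -> : (x / 2 + 1) * (3 * (21 * (y / x))) = 63 / 2 * y + 63 * (y / x).
  by field; rewrite gt_eqF.
have : y / x <= y by rewrite ler_pdivrMr // ler_peMr // ltW.
have y1 : 1 <= y by apply: le_trans ty.
by lra.
Qed.

Lemma harmonic_le t : \sum_(1 <= k < 2 ^ t) (k%:R : R)^-1 <= t%:R.
Proof.
elim: t => [|t IH]; first by rewrite big_geq.
have le : (2 ^ t <= 2 ^ t.+1)%N by rewrite leq_exp2l.
have t0 : (0 < 2 ^ t)%N by rewrite expn_gt0.
rewrite (@big_cat_nat _ _ _ (2 ^ t)) //= -[leRHS]natr1 lerD //.
apply: le_trans (_ : \sum_(2 ^ t <= k < 2 ^ t.+1) ((2 ^ t)%:R : R)^-1 <= _).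
  rewrite big_nat_cond [leRHS]big_nat_cond; apply: ler_sum => k /andP[/andP[k1 _] _].
  by rewrite lef_pV2 ?posrE ?ltr0n ?ler_nat // (leq_trans t0).
rewrite big_const_nat iter_addr_0 expnS mul2n -addnn addnK -[X in X *+ _]mul1r -mulrnAr.
by rewrite mul1r -mulr_natr mulVf // pnatr_eq0 -lt0n.
Qed.

Lemma sum_inv_sqrt_le n : \sum_(1 <= i < n.+1) (Num.sqrt (i%:R : R))^-1 <= 2 * Num.sqrt n%:R.
Proof.
elim: n => [|n IH]; first by rewrite big_geq // mulr_ge0 ?sqrtr_ge0.
rewrite big_nat_recr //=; apply: le_trans (lerD IH (lexx _)) _.
set a := Num.sqrt n%:R; set b := Num.sqrt n.+1%:R.
have a0 : 0 <= a by exact: sqrtr_ge0.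
have b0 : 0 < b by rewrite sqrtr_gt0 ltr0n.
have ab : a <= b by rewrite ler_wsqrtr // ler_nat.
have e : b ^+ 2 = a ^+ 2 + 1 by rewrite !sqr_sqrtr // natr1.
rewrite -(ler_pM2r b0) mulrDl mulVf ?gt_eqF //.
by nra.
Qed.

(** For i <= n / 2 the factor n - i is at least n / 2, and the 1 / sqrt i sum to at most 2 sqrt n.
    For the other i, sqrt i is at least sqrt n / 2, and the 1 / (n - i) have a harmonic sum, at most
    t. *)
Lemma sum_weights_le n t : (0 < t)%N -> (0 < n <= 2 ^ t)%N ->
  \sum_(1 <= i < n) (Num.sqrt (i%:R : R) * (n - i)%:R)^-1 <= 6 * (t%:R / Num.sqrt n%:R).
Proof.
move=> t0 /andP[n0 nt]; set x : R := Num.sqrt n%:R.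
have xE : x ^+ 2 = n%:R by rewrite sqr_sqrtr.
have x0 : 0 < x by rewrite sqrtr_gt0 ltr0n.
apply: le_trans (_ : \sum_(1 <= i < n) (2 / n%:R * (Num.sqrt (i%:R : R))^-1 +
    2 / x * (n - i)%:R^-1) <= _).
  rewrite big_nat_cond [leRHS]big_nat_cond; apply: ler_sum => i /andP[/andP[i0 ni] _].
  have s0 : 0 < Num.sqrt (i%:R : R) by rewrite sqrtr_gt0 ltr0n.
  have d0 : (0 : R) < (n - i)%:R by rewrite ltr0n subn_gt0.
  have nR : (0 : R) < n%:R by rewrite ltr0n.
  have [le|lt] := leqP (2 * i) n.
    apply: le_trans (_ : 2 / n%:R * (Num.sqrt (i%:R : R))^-1 <= _); last first.
      by rewrite lerDl mulr_ge0 ?divr_ge0 ?invr_ge0 // ltW.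
    rewrite invfM mulrC ler_wpM2r ?invr_ge0 ?(ltW s0) //.
    rewrite ler_pdivlMr // ler_pdivrMl // -natrM ler_nat; lia.
  apply: le_trans (_ : 2 / x * (n - i)%:R^-1 <= _); last first.
    by rewrite lerDr mulr_ge0 ?divr_ge0 ?invr_ge0 ?(ltW s0) // ltW.
  rewrite invfM ler_wpM2r ?invr_ge0 ?(ltW d0) //.
  rewrite ler_pdivlMr // ler_pdivrMl // -(@ler_pXn2r _ 2) ?nnegrE ?mulr_ge0 ?(ltW x0) ?(ltW s0) //.
  rewrite exprMn xE sqr_sqrtr // -natrX -natrM ler_nat; lia.
rewrite big_split /= -!mulr_sumr.
have h1 : \sum_(1 <= i < n) (Num.sqrt (i%:R : R))^-1 <= 2 * x.
  apply: le_trans (sum_inv_sqrt_le n); rewrite big_nat_recr //= lerDl.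
  by rewrite invr_ge0 sqrtr_ge0.
have h2 : \sum_(1 <= i < n) ((n - i)%:R : R)^-1 <= t%:R.
  rewrite big_nat_rev /=; apply: le_trans (harmonic_le t).
  rewrite (@big_cat_nat _ _ _ n 1 (2 ^ t)) //= -[leLHS]addr0 lerD //.
    rewrite big_nat_cond [leRHS]big_nat_cond; apply: ler_sum => i /andP[/andP[i0 ni] _].
    by rewrite lef_pV2 ?posrE ?ltr0n ?ler_nat; lia.
  by apply: sumr_ge0 => i _; rewrite invr_ge0.
apply: le_trans (lerD (ler_wpM2l _ h1) (ler_wpM2l _ h2)) _; rewrite ?divr_ge0 ?(ltW x0) //.
have -> : 2 / n%:R * (2 * x) = 4 * (1 / x).
  by rewrite -xE; field; rewrite gt_eqF.
have -> : 2 / x * t%:R = 2 * (t%:R / x) by ring.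
have : 1 / x <= t%:R / x by rewrite ler_wpM2r ?invr_ge0 ?(ltW x0) // ler1n.
by lra.
Qed.

End SumEstimates.

(** * From the bilinear estimate to sums over q, r and m with a common cutoff *)

Section Boxes.
Variables (R : realType) (p : nat) (psi : 'F_p -> R[i]).
Local Notation nc := (@Normc.normc R).
Hypothesis pp : prime p.
Hypothesis psiD : forall x y, psi (x + y) = psi x * psi y.
Hypothesis psi_norm : forall x, nc (psi x) = 1.
Hypothesis psi_neq1 : exists x, psi x != 1.

Let Q := trunc_log 2 p.
Variable t : nat.
Hypothesis t3 : (3 <= t)%N.
Hypothesis Qt : (Q < 2 ^ t)%N.

Local Notation f n := (psi ((n)%:R^-1)).

Lemma ln_le_2t y : (y < p)%N -> ln (y%:R : R) <= (2 ^ t)%:R.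
Proof.
case: y => [|y] yp; first by rewrite ln0.
have /andP[_ Qp] := trunc_log_bounds (isT : 1 < 2)%N (prime_gt0 pp).
apply: le_trans (_ : ln ((2 ^ Q.+1)%:R : R) <= _).
  by rewrite ler_ln ?posrE ?ltr0n ?expn_gt0 // ler_nat ltnW // (ltn_trans yp).
rewrite natrX lnXn ?ltr0n // -[_ *+ Q.+1]mulr_natl.
apply: le_trans (_ : Q.+1%:R * 1 <= _); first by rewrite ler_wpM2l ?ln2_le1.
by rewrite mulr1 ler_nat.
Qed.

Lemma big_nat_ord (V : nmodType) n (P : pred nat) (F : nat -> V) : (n < p)%N ->
  \sum_(1 <= q < n.+1 | P q) F q = \sum_(q < p | P q && (0 < q <= n)%N) F q.
Proof.
move=> np; rewrite (big_nat_widen _ _ _ _ _ np) (big_nat_widenl _ 0) // big_mkord.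
by apply: eq_bigl => q /=; rewrite -andbA ltnS [(_ <= n)%N && _]andbC.
Qed.

Lemma lev_box r j : prime r -> lev r = j -> prime r && (2 ^ j < r <= 2 * 2 ^ j)%N.
Proof. by move=> pr <-; rewrite pr -expnS lev_bounds ?prime_gt1. Qed.

(** For fixed m this is a bilinear sum over q and r. The cutoff T is the same for all q, so the
    condition r m <= T does not tie q to r. There are at most T / 2^j values of m. The predicate P
    will select the q that share a cutoff. *)
Lemma class_sum i j T N (P : pred nat) : (T < p)%N -> (N < p)%N -> (t <= i)%N ->
  good Q t i j ->
  \sum_(1 <= q < N.+1 | [&& prime q, lev q == i & P q])
    nc (\sum_(1 <= r < T.+1 | prime r && (lev r == j))
      (ln r%:R)%:C%C * \sum_(1 <= m < (T %/ r).+1) f (q * (r * m))%N) <=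
  T%:R * (2 ^ i)%:R / (2 ^ (4 * t))%:R.
Proof.
move=> Tp Np ti /and3P[tj g1 g2].
have t0 : (0 : R) < (2 ^ t)%:R by rewrite ltr0n expn_gt0.
(* m becomes the outer variable, at most T / 2^j because r > 2^j; its range for a given r turns into
   the condition r m <= T on r. *)
have inner q : \sum_(1 <= r < T.+1 | prime r && (lev r == j))
      (ln (r%:R : R))%:C%C * \sum_(1 <= m < (T %/ r).+1) f (q * (r * m))%N =
    \sum_(1 <= m < (T %/ 2 ^ j).+1) \sum_(1 <= r < T.+1 | [&& prime r, lev r == j & (r * m <= T)%N])
      (ln (r%:R : R))%:C%C * f (q * (r * m))%N.
  rewrite (exchange_big_dep (fun r => prime r && (lev r == j))) /=; last first.
    by move=> m r _ /and3P[-> ->].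
  apply: eq_bigr => r /andP[pr /eqP lr]; rewrite mulr_sumr.
  have /andP[r2 _] := lev_bounds (prime_gt1 pr).
  rewrite (@big_nat_widen _ _ _ _ (T %/ r).+1 (T %/ 2 ^ j).+1) /=; last first.
    by rewrite ltnS leq_div2l ?expn_gt0 // -lr ltnW.
  apply: eq_bigl => m; rewrite pr lr eqxx /= ltnS leq_divRL ?prime_gt0 //.
  by rewrite mulnC.
apply: le_trans (_ : \sum_(1 <= m < (T %/ 2 ^ j).+1)
    (2 ^ t)%:R * ((2 ^ i)%:R * (2 ^ j)%:R / (2 ^ (5 * t))%:R) <= _); last first.
  rewrite big_const_nat subn1 /= iter_addr_0.
  have -> : (2 ^ (5 * t))%:R = (2 ^ t)%:R * (2 ^ (4 * t))%:R :> R.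
    by rewrite -natrM -expnD; congr ((2 ^ _)%:R); ring.
  have e0 : (0 : R) < (2 ^ (4 * t))%:R by rewrite ltr0n expn_gt0.
  have -> : (2 ^ t)%:R * ((2 ^ i)%:R * (2 ^ j)%:R / ((2 ^ t)%:R * (2 ^ (4 * t))%:R)) =
     (2 ^ j)%:R * ((2 ^ i)%:R / (2 ^ (4 * t))%:R) :> R.
    by field; rewrite !gt_eqF.
  rewrite -[_ *+ (T %/ _)]mulr_natl; set c := _ / (2 ^ (4 * t))%:R.
  have c0 : 0 <= c by rewrite divr_ge0.
  apply: le_trans (_ : ((T %/ 2 ^ j) * 2 ^ j)%:R * c <= _).
    by rewrite natrM -mulrA.
  by rewrite /c -[leRHS]mulrA ler_wpM2r // ler_nat leq_trunc_div.
under eq_bigr do rewrite inner.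
apply: le_trans (_ : \sum_(1 <= q < N.+1 | [&& prime q, lev q == i & P q])
  \sum_(1 <= m < (T %/ 2 ^ j).+1)
    nc (\sum_(1 <= r < T.+1 | [&& prime r, lev r == j & (r * m <= T)%N])
      (ln (r%:R : R))%:C%C * f (q * (r * m))%N) <= _).
  by apply: ler_sum => q _; exact: normc_sum.
rewrite exchange_big /= big_nat_cond [leRHS]big_nat_cond.
apply: ler_sum => m /andP[/andP[m0 mT] _].
have mp : (m < p)%N.
  by apply: leq_ltn_trans Tp; apply: leq_trans (leq_div T (2 ^ j)); rewrite -ltnS.
have m1 : (m%:R : 'F_p) != 0 by rewrite -(dvdn_pcharf (pchar_Fp pp)) gtnNdvd.
pose A := [set x : 'I_p | [&& prime x, lev x == i & P x] && (0 < x <= N)%N].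
pose B := [set y : 'I_p | [&& prime y, lev y == j & (y * m <= T)%N] && (0 < y <= T)%N].
(* The weights ln r, at most 2^t, are scaled to modulus at most 1, and 1 / m is absorbed into the
   character, which stays nontrivial since 0 < m < p. *)
pose beta (y : 'I_p) : R[i] := (ln (y : nat)%:R / (2 ^ t)%:R)%:C%C.
pose psim x := psi (m%:R^-1 * x).
have psimD x y : psim (x + y) = psim x * psim y by rewrite /psim mulrDr psiD.
have psim_norm x : nc (psim x) = 1 by exact: psi_norm.
have psim_neq1 : exists x, psim x != 1.
  by have [x px] := psi_neq1; exists (m%:R * x); rewrite /psim mulKf.
have beta1 y : nc (beta y) <= 1.
  rewrite normc_real ger0_norm ?divr_ge0 ?ln_nat_ge0 //.
  by rewrite ler_pdivrMr // mul1r ln_le_2t.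
have hA (x : 'I_p) : x \in A -> prime x && (2 ^ i < x <= 2 * 2 ^ i)%N.
  by rewrite inE => /andP[/and3P[px /eqP lx _] _]; exact: lev_box.
have hB (x : 'I_p) : x \in B -> prime x && (2 ^ j < x <= 2 * 2 ^ j)%N.
  by rewrite inE => /andP[/and3P[px /eqP lx _] _]; exact: lev_box.
have := bilinear_box pp psimD psim_norm psim_neq1 t3 Qt ti tj g1 g2 hA hB beta1.
move=> /(ler_wpM2l (ltW t0)); apply: le_trans.
rewrite big_nat_ord // mulr_sumr le_eqVlt; apply/orP; left; apply/eqP.
apply: eq_big => [x|x _]; first by rewrite inE.
rewrite big_nat_ord //; have -> : (2 ^ t)%:R = nc ((2 ^ t)%:R%:C)%C.
  by rewrite normc_real ger0_norm // ltW.
rewrite -Normc.normcM mulr_sumr; congr nc; apply: eq_big => [y|y _]; first by rewrite inE.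
rewrite /beta mulrA -rmorphM /= mulrCA divff ?gt_eqF // mulr1; congr (_ * psi _).
by rewrite !natrM !invfM; ring.
Qed.

End Boxes.

Lemma ln2_ge_half (R : realType) : 1 / 2 <= ln (2 : R).
Proof.
have : ln (1 + - (1 / 2) : R) <= - (1 / 2) by apply: le_ln1Dx; lra.
have -> : 1 + - (1 / 2) = 2^-1 :> R by lra.
by rewrite lnV ?posrE //; lra.
Qed.

(** * The primes q of one level i, away from both ends of the range *)

Section MiddleBox.
Variables (R : realType) (p : nat) (psi : 'F_p -> R[i]).
Local Notation nc := (@Normc.normc R).
Hypothesis pp : prime p.
Hypothesis psiD : forall x y, psi (x + y) = psi x * psi y.
Hypothesis psi_norm : forall x, nc (psi x) = 1.
Hypothesis psi_neq1 : exists x, psi x != 1.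

Let Q := trunc_log 2 p.
Variables (t N i : nat).
Hypothesis t3 : (3 <= t)%N.
Hypothesis Qt : (Q < 2 ^ t)%N.
Hypothesis Np : (N < p)%N.
Hypothesis N0 : (0 < N)%N.
Hypothesis ti : (t <= i)%N.
Hypothesis iN : (i + t <= trunc_log 2 N)%N.

Local Notation f n := (psi ((n)%:R^-1)).
Let n0 := trunc_log 2 N.
Let h := (2 ^ (i - t))%N.

(* N / q is replaced by the smaller cutoff T q, which takes only about 2^t values on the box. *)
Let s q := (q.-1 %/ h).+1.
Let T q := (N %/ (s q * h))%N.

(** s q * h is the least multiple of h that is at least q; the other bounds follow from 2^i = 2^t
    h. *)
Lemma cutoff_bounds q : prime q -> lev q = i ->
  [/\ (q <= s q * h)%N, (2 ^ i <= s q * h)%N, (s q * h < q + h)%N,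
      (s q <= 2 * 2 ^ t)%N & (s q * h <= 2 ^ i.+1)%N].
Proof.
move=> pq lq; have q1 := prime_gt1 pq; have := lev_bounds q1; rewrite lq => /andP[q2 q3].
have h0 : (0 < h)%N by rewrite expn_gt0.
have a := leq_trunc_div q.-1 h; have b := ltn_ceil q.-1 h0.
have qs : (q <= s q * h)%N by rewrite /s; lia.
have e : (2 ^ i = 2 ^ t * h)%N by rewrite /h -expnD subnKC.
have ss : (s q <= 2 * 2 ^ t)%N.
  by rewrite /s ltn_divLR // -mulnA -e -expnS; lia.
split=> //; first by lia.
  by rewrite /s mulSn; lia.
by rewrite expnS e mulnA leq_mul2r ss orbT.
Qed.

Lemma cutoff_ge q : prime q -> lev q = i -> (2 ^ (n0 - i.+1) <= T q)%N.
Proof.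
move=> pq lq; have [q1 _ _ _ q5] := cutoff_bounds pq lq.
have q0 := prime_gt0 pq; rewrite /T leq_divRL; last by apply: leq_trans q1.
apply: leq_trans (trunc_logP (isT : 1 < 2)%N N0); rewrite -/n0.
apply: leq_trans (leq_mul (leqnn _) q5) _.
by rewrite -expnD leq_exp2l // subnK //; lia.
Qed.

Lemma cutoff_le q : prime q -> lev q = i -> (T q)%:R <= N%:R / q%:R :> R.
Proof.
move=> pq lq; have [q1 _ _ _ q5] := cutoff_bounds pq lq.
rewrite ler_pdivlMr ?ltr0n ?prime_gt0 // -natrM ler_nat.
apply: leq_trans (leq_trunc_div N (s q * h)); exact: leq_mul.
Qed.

(** The relative change from q to s q * h is less than h / 2^i = 2^(-t); the 1 comes from rounding T
    q down. *)
Lemma cutoff_error q : prime q -> lev q = i ->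
  (N %/ q)%:R - (T q)%:R <= N%:R / q%:R / (2 ^ t)%:R + 1 :> R.
Proof.
move=> pq lq; have [q1 q2 q3 _ q5] := cutoff_bounds pq lq.
have q0 : (0 : R) < q%:R by rewrite ltr0n prime_gt0.
have S0n : (0 < s q * h)%N by apply: leq_trans q1; rewrite prime_gt0.
have S0 : (0 : R) < (s q * h)%:R by rewrite ltr0n.
have t0 : (0 : R) < (2 ^ t)%:R by rewrite ltr0n expn_gt0.
have a : (N %/ q)%:R <= N%:R / q%:R :> R.
  by rewrite ler_pdivlMr // -natrM ler_nat leq_trunc_div.
have b : N%:R / (s q * h)%:R <= (T q)%:R + 1 :> R.
  by rewrite ler_pdivrMr // natr1 -natrM ler_nat ltnW // /T ltn_ceil.
suff c : N%:R / q%:R - N%:R / (s q * h)%:R <= N%:R / q%:R / (2 ^ t)%:R :> R by lra.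
have -> : N%:R / q%:R - N%:R / (s q * h)%:R = N%:R / q%:R * (((s q * h)%:R - q%:R) / (s q * h)%:R) :> R.
  by move: S0; move: (s q * h)%:R => u u0; field; rewrite !gt_eqF.
rewrite ler_wpM2l ?divr_ge0 ?(ltW q0) // ler_pdivrMr // mulrC ler_pdivlMr //.
rewrite -natrB // -natrM ler_nat.
have e : (2 ^ i = 2 ^ t * h)%N by rewrite /h -expnD subnKC.
by apply: leq_trans q2; rewrite e mulnC leq_mul2l; lia.
Qed.

(** The part of level j in the sum over r that [log_weight] produces from the sum over m <= T q. *)
Let Y q j : R := nc (\sum_(1 <= r < (T q).+1 | prime r && (lev r == j))
      (ln r%:R)%:C%C * \sum_(1 <= m < (T q %/ r).+1) f (q * (r * m))%N).

Lemma Y_ge0 q j : 0 <= Y q j.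
Proof. exact: normc_ge0. Qed.

Lemma normc_sum_f_le g n : nc (\sum_(1 <= m < n.+1) f (g m)) <= n%:R.
Proof.
apply: le_trans (normc_sum _ _ _) _; under eq_bigr do rewrite psi_norm.
by rewrite big_const_nat subn1 iter_addr_0.
Qed.

Lemma Y_trivial q j : Y q j <= 2 * (T q)%:R.
Proof.
apply: le_trans (normc_sum _ _ _) _.
apply: le_trans (_ : \sum_(1 <= r < (T q).+1 | prime r && (lev r == j))
   (T q)%:R * (ln (r%:R : R) / r%:R) <= _).
  apply: ler_sum => r /andP[pr _]; rewrite Normc.normcM normc_real ger0_norm ?ln_nat_ge0 //.
  rewrite mulrCA ler_wpM2l ?ln_nat_ge0 //; apply: le_trans (normc_sum_f_le _ _) _.
  by rewrite ler_pdivlMr ?ltr0n ?prime_gt0 // -natrM ler_nat leq_trunc_div.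
rewrite -mulr_sumr mulrC ler_wpM2r //; apply: le_trans (box_mertens _ _ _) _.
by have := ln2_le1 R; lra.
Qed.

(** Grouping the q by v = s q makes the cutoff constant in each group, so that [class_sum] applies.
    At most 2^t levels j and 2 * 2^t + 1 values of v cost 4 * 2^(2t) out of the saving 2^(4t). *)
Lemma sum_good_le :
  \sum_(1 <= q < N.+1 | prime q && (lev q == i)) \sum_(j < Q.+1 | good Q t i j) Y q j <=
  4 * N%:R / (2 ^ (2 * t))%:R.
Proof.
have e4 : (0 : R) < (2 ^ (4 * t))%:R by rewrite ltr0n expn_gt0.
rewrite exchange_big /=.
apply: le_trans (_ : \sum_(j < Q.+1 | good Q t i j)
   ((2 * 2 ^ t).+1)%:R * (N%:R / (2 ^ (4 * t))%:R) <= _).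
  apply: ler_sum => j gj.
  rewrite (eq_bigr (fun q => \sum_(v < (2 * 2 ^ t).+1 | s q == v) Y q j)); last first.
    move=> q /andP[pq /eqP lq]; have [_ _ _ q4 _] := cutoff_bounds pq lq.
    by rewrite (big_pred1 (Ordinal (q4 : s q < (2 * 2 ^ t).+1)%N)).
  rewrite (exchange_big_dep predT) //= mulr_natl -[X in _ *+ X]card_ord -sumr_const.
  apply: ler_sum => v _.
  under eq_bigl do rewrite -andbA.
  (* No q of level i has v h < 2^i; otherwise 2^i times the cutoff is at most N. *)
  have [small|big] := ltnP (v * h) (2 ^ i).
    rewrite big1 ?divr_ge0 // => q /and3P[pq /eqP lq /eqP sv].
    by have [_ q2 _ _ _] := cutoff_bounds pq lq; move: q2; rewrite sv leqNgt small.
  have i0 : (0 < 2 ^ i)%N by rewrite expn_gt0.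
  have vh : (0 < v * h)%N by apply: leq_trans big.
  pose Tv := (N %/ (v * h))%N.
  have Tp : (Tv < p)%N by apply: leq_ltn_trans Np; exact: leq_div.
  have cs := class_sum pp psiD psi_norm psi_neq1 t3 Qt (fun q => s q == v) Tp Np ti gj.
  apply: le_trans (_ : Tv%:R * (2 ^ i)%:R / (2 ^ (4 * t))%:R <= _).
    apply: le_trans cs; rewrite le_eqVlt; apply/orP; left; apply/eqP/eq_bigr.
    by move=> q /and3P[_ _ /eqP sv]; rewrite /Y /T sv.
  rewrite ler_wpM2r ?invr_ge0 ?(ltW e4) // -natrM ler_nat.
  by apply: leq_trans (leq_trunc_div N (v * h)); rewrite leq_mul2l big orbT.
rewrite sumr_const -[X in X <= _]mulr_natl.
apply: le_trans (_ : (2 ^ t)%:R * ((4 * 2 ^ t)%:R * (N%:R / (2 ^ (4 * t))%:R)) <= _).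
  have z : 0 <= N%:R / (2 ^ (4 * t))%:R :> R by rewrite divr_ge0.
  apply: ler_pM; rewrite ?mulr_ge0 // ?ler_nat.
    by apply: leq_trans Qt; rewrite -[X in (_ <= X)%N]card_ord max_card.
  rewrite ler_wpM2r // ler_nat.
  by have := expn_gt0 2 t; move: (2 ^ t)%N => u; lia.
have -> : (2 ^ (4 * t))%:R = (2 ^ (2 * t))%:R * ((2 ^ t)%:R * (2 ^ t)%:R) :> R.
  by rewrite -!natrM -!expnD; congr ((2 ^ _)%:R); ring.
have a0 : (0 : R) < (2 ^ (2 * t))%:R by rewrite ltr0n expn_gt0.
have b0 : (0 : R) < (2 ^ t)%:R by rewrite ltr0n expn_gt0.
rewrite natrM le_eqVlt; apply/orP; left; apply/eqP; field.
by rewrite !gt_eqF.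
Qed.

Let bad := #|[set j : 'I_Q.+1 | ~~ good Q t i j]|.

(** The second use of [log_weight]. Each bad level is estimated by [Y_trivial], the good ones are
    kept for [sum_good_le]. *)
Lemma sum_cutoff_le q : prime q -> lev q = i ->
  ln (T q)%:R * nc (\sum_(1 <= m < (T q).+1) f (q * m)%N) <=
  (5 + 2 * bad%:R) * (T q)%:R + \sum_(j < Q.+1 | good Q t i j) Y q j.
Proof.
move=> pq lq.
have f1 n : nc (f (q * n)%N) <= 1 by rewrite psi_norm.
have /le_trans := @log_weight R (fun m => f (q * m)%N) (T q) f1; apply.
rewrite [(5 + _) * _]mulrDl -[leRHS]addrA lerD2l (@sum_lev _ (T q) Q.+1)
  => [|r /andP[r1 rT]]; last first.
  have /andP[_ Qp] := trunc_log_bounds (isT : 1 < 2)%N (prime_gt0 pp).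
  have /andP[r2 _] := lev_bounds r1.
  rewrite -(@ltn_exp2l 2) //; apply: leq_trans r2 (leq_trans rT _).
  by apply: leq_trans (ltnW Qp); apply: leq_trans (ltnW Np); exact: leq_div.
apply: le_trans (normc_sum _ _ _) _.
rewrite (bigID (fun j : 'I_Q.+1 => good Q t i j)) /= addrC lerD //.
apply: le_trans (_ : \sum_(j < Q.+1 | ~~ good Q t i j) 2 * (T q)%:R <= _).
  by apply: ler_sum => j _; exact: Y_trivial.
rewrite sumr_const -[X in X <= _]mulr_natl mulrA [2 * bad%:R]mulrC /bad.
by rewrite cardsE.
Qed.

(** Dividing [sum_cutoff_le] by ln (T q) gives the term in 1 / (n0 - i). In 10 / 2^t, 8 comes from
    the good levels and 2 from the change of cutoff, whose rounding gives 2^(i+1). *)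
Lemma middle_box :
  \sum_(1 <= q < N.+1 | prime q && (lev q == i))
     ln q%:R * nc (\sum_(1 <= m < (N %/ q).+1) f (q * m)%N) <=
  N%:R * ((20 + 8 * bad%:R) / (n0 - i)%:R + 10 / (2 ^ t)%:R) + (2 ^ i.+1)%:R.
Proof.
have nR : (0 : R) <= N%:R by [].
have t0 : (0 : R) < (2 ^ t)%:R by rewrite ltr0n expn_gt0.
have d3 : (3 <= n0 - i)%N by rewrite /n0; lia.
have d0 : (0 : R) < (n0 - i)%:R by rewrite ltr0n; lia.
have l1 := ln2_le1 R; have l2 := ln2_ge_half R.
(* T q >= 2^(n0 - i - 1), and n0 - i - 1 is at least half of n0 - i. *)
have lnT q : prime q -> lev q = i -> (n0 - i)%:R / 2 * ln 2 <= ln ((T q)%:R : R).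
  move=> pq lq; apply: le_trans (_ : ln ((2 ^ (n0 - i.+1))%:R : R) <= _); last first.
    have c := cutoff_ge pq lq.
    by rewrite ler_ln ?posrE ?ltr0n ?expn_gt0 ?ler_nat // (leq_trans _ c) // expn_gt0.
  rewrite natrX lnXn ?ltr0n // -[_ *+ (n0 - i.+1)]mulr_natl ler_wpM2r //; first by lra.
  by rewrite ler_pdivrMr // -natrM ler_nat; lia.
(* c / 2 / ln 2 is 5 + 2 bad divided by the lower bound of [lnT]; the factor 2 ln 2 of [box_mertens]
   turns it back into c. *)
pose c : R := (20 + 8 * bad%:R) / (n0 - i)%:R.
have c0 : 0 <= c by rewrite divr_ge0 ?addr_ge0 ?mulr_ge0.
have one q : prime q -> lev q = i -> (q <= N)%N ->
  ln q%:R * nc (\sum_(1 <= m < (N %/ q).+1) f (q * m)%N) <=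
  ln q%:R / q%:R * (N%:R * (c / 2 / ln 2 + (2 ^ t)%:R^-1)) + ln q%:R +
  2 * (2 ^ t)%:R * \sum_(j < Q.+1 | good Q t i j) Y q j.
  move=> pq lq qN; have q0 : (0 : R) < q%:R by rewrite ltr0n prime_gt0.
  set G := \sum_(j < _ | _) _.
  have G0 : 0 <= G by apply: sumr_ge0 => j _; exact: Y_ge0.
  have lq0 := ln_nat_ge0 R q.
  have lq1 : ln (q%:R : R) <= (2 ^ t)%:R.
    by apply: (ln_le_2t R pp Qt); apply: leq_ltn_trans Np.
  set D := nc _; pose D' := nc (\sum_(1 <= m < (T q).+1) f (q * m)%N).
  have [q1 _ _ _ _] := cutoff_bounds pq lq.
  have TN : (T q <= N %/ q)%N by rewrite leq_div2l ?prime_gt0.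
  have DD : D <= D' + (N%:R / q%:R / (2 ^ t)%:R + 1).
    apply: le_trans (_ : D' + ((N %/ q)%:R - (T q)%:R) <= _); last first.
      by rewrite lerD2l; exact: cutoff_error.
    rewrite /D (@big_cat_nat _ _ _ (T q).+1) //=.
    apply: le_trans (normcD _ _) _; rewrite lerD2l -natrB //.
    apply: le_trans (normc_sum _ _ _) _; under eq_bigr do rewrite psi_norm.
    by rewrite big_const_nat iter_addr_0 subSS.
  have hD' := sum_cutoff_le pq lq; rewrite -/D' -/G in hD'.
  have hl := lnT q pq lq.
  have lT2 : 1 / 2 <= ln ((T q)%:R : R).
    apply: le_trans hl; have : (3 : R) <= (n0 - i)%:R by rewrite (ler_nat R 3).
    by move: l2; set u := ln 2; set w := _%:R; nra.
  have lT0 : 0 < ln ((T q)%:R : R) by apply: lt_le_trans lT2; lra.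
  have D'le : D' <= N%:R / q%:R * (c / 2 / ln 2) + 2 * G.
    rewrite -(ler_pM2l lT0); apply: le_trans hD' _; rewrite mulrDr lerD //; last first.
      by rewrite mulrA ler_peMl // ; lra.
    apply: le_trans (_ : (5 + 2 * bad%:R) * (N%:R / q%:R) <= _).
      by rewrite ler_wpM2l ?addr_ge0 ?mulr_ge0 //; exact: cutoff_le.
    rewrite mulrC mulrCA ler_wpM2l ?divr_ge0 ?(ltW q0) //.
    apply: le_trans (_ : ((n0 - i)%:R / 2 * ln 2) * (c / 2 / ln 2) <= _); last first.
      by rewrite ler_wpM2r // !divr_ge0 //; lra.
    rewrite /c le_eqVlt; apply/orP; left; apply/eqP; field.
    by rewrite !gt_eqF //; lra.
  apply: le_trans (ler_wpM2l lq0 DD) _.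
  have -> : ln q%:R / q%:R * (N%:R * (c / 2 / ln 2 + (2 ^ t)%:R^-1)) + ln q%:R + 2 * (2 ^ t)%:R * G
    = ln q%:R * (N%:R / q%:R * (c / 2 / ln 2) + (N%:R / q%:R / (2 ^ t)%:R + 1)) +
      (2 ^ t)%:R * (2 * G) by ring.
  apply: le_trans (_ : ln q%:R * ((N%:R / q%:R * (c / 2 / ln 2) + 2 * G) +
    (N%:R / q%:R / (2 ^ t)%:R + 1)) <= _).
    by rewrite ler_wpM2l // lerD2r.
  rewrite addrAC [leLHS]mulrDr lerD2l ler_wpM2r // mulr_ge0 //.
apply: le_trans (_ : \sum_(1 <= q < N.+1 | prime q && (lev q == i))
   (ln q%:R / q%:R * (N%:R * (c / 2 / ln 2 + (2 ^ t)%:R^-1)) + ln q%:R +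
    2 * (2 ^ t)%:R * \sum_(j < Q.+1 | good Q t i j) Y q j) <= _).
  rewrite big_nat_cond [leRHS]big_nat_cond.
  by apply: ler_sum => q /andP[/andP[q0 qN] /andP[pq /eqP lq]]; exact: one.
rewrite !big_split /= -mulr_suml -mulr_sumr.
have h1 := box_mertens R N i; have h2 := box_theta R N i; have h3 := sum_good_le.
set A := \sum_(_ <= _ < _ | _) _ / _ in h1 *.
set B := \sum_(_ <= _ < _ | _) ln _ in h2 *.
set G := \sum_(_ <= _ < _ | _) \sum_(_ < _ | _) _ in h3 *.
have h2' : B <= (2 ^ i.+1)%:R by apply: le_trans h2 _; rewrite ler_piMr.
have h1' : A * (N%:R * (c / 2 / ln 2 + (2 ^ t)%:R^-1)) <= N%:R * (c + 2 / (2 ^ t)%:R).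
  apply: le_trans (ler_wpM2r _ h1) _.
    by rewrite mulr_ge0 // addr_ge0 ?invr_ge0 ?(ltW t0) // !divr_ge0 //; lra.
  have -> : 2 * ln 2 * (N%:R * (c / 2 / ln 2 + (2 ^ t)%:R^-1)) = N%:R * (c + 2 * ln 2 / (2 ^ t)%:R).
    by field; rewrite !gt_eqF //; lra.
  by rewrite ler_wpM2l // lerD2l ler_wpM2r ?invr_ge0 ?(ltW t0) //; lra.
have h3' : 2 * (2 ^ t)%:R * G <= N%:R * (8 / (2 ^ t)%:R).
  apply: le_trans (ler_wpM2l _ h3) _; first by rewrite mulr_ge0 // ltW.
  rewrite mul2n -addnn expnD natrM le_eqVlt; apply/orP; left; apply/eqP; field.
  by rewrite gt_eqF.
have -> : N%:R * (c + 10 / (2 ^ t)%:R) = N%:R * (c + 2 / (2 ^ t)%:R) + N%:R * (8 / (2 ^ t)%:R) :> R.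
  by ring.
by lra.
Qed.

End MiddleBox.

(** * Summation over the levels of q *)

Section CharSum.
Variables (R : realType) (p : nat) (psi : 'F_p -> R[i]).
Local Notation nc := (@Normc.normc R).
Hypothesis pp : prime p.
Hypothesis psiD : forall x y, psi (x + y) = psi x * psi y.
Hypothesis psi_norm : forall x, nc (psi x) = 1.
Hypothesis psi_neq1 : exists x, psi x != 1.

Let Q := trunc_log 2 p.
Variables (t N : nat).
Hypothesis t3 : (3 <= t)%N.
Hypothesis Qt : (Q < 2 ^ t)%N.
Hypothesis Np : (N < p)%N.
Hypothesis N2 : (2 <= N)%N.

Local Notation f n := (psi ((n)%:R^-1)).
Let n0 := trunc_log 2 N.

Let E i : R := \sum_(1 <= q < N.+1 | prime q && (lev q == i))
     ln q%:R * nc (\sum_(1 <= m < (N %/ q).+1) f (q * m)%N).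

Lemma box_trivial i : E i <= 2 * N%:R.
Proof.
apply: le_trans (_ : N%:R * \sum_(1 <= q < N.+1 | prime q && (lev q == i))
   ln (q%:R : R) / q%:R <= _).
  rewrite mulr_sumr; apply: ler_sum => q /andP[pq _].
  rewrite mulrCA ler_wpM2l ?ln_nat_ge0 //.
  apply: le_trans (normc_sum_f_le psi_norm _ _) _.
  by rewrite ler_pdivlMr ?ltr0n ?prime_gt0 // -natrM ler_nat leq_trunc_div.
rewrite mulrC ler_wpM2r //; apply: le_trans (box_mertens _ _ _) _.
by have := ln2_le1 R; lra.
Qed.

(** [middle_box] with [bad_count_le]; the condition 56 t <= i keeps the gap small enough for the
    latter. *)
Lemma box_middle i : (56 * t <= i)%N -> (i + t <= n0)%N ->
  E i <= 820 * N%:R * (Q%:R * t%:R) * (Num.sqrt i%:R * (n0 - i)%:R)^-1 +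
    10 * N%:R / (2 ^ t)%:R + (2 ^ i.+1)%:R.
Proof.
move=> ti iN.
have n0Q : (n0 <= Q)%N by apply: leq_trunc_log; exact: ltnW.
have iQ : (i <= Q)%N by lia.
have i0 : (0 < i)%N by lia.
(* With x = Q / (2i) rounded down, 2 gap = 28 x t + 28 t, while 112 x t <= Q and 56 t <= Q. *)
have gapQ : (2 * gap Q t i <= Q)%N.
  have := leq_trunc_div Q (2 * i); set x := (Q %/ (2 * i))%N => xQ.
  have : (x * (2 * (56 * t)) <= Q)%N by apply: leq_trans xQ; rewrite !leq_mul2l ti !orbT.
  have : (56 * t <= Q)%N by apply: leq_trans iQ.
  rewrite /gap -/x; have -> : (2 * (14 * x.+1 * t) = 28 * (x * t) + 28 * t)%N by ring.
  have -> : (x * (2 * (56 * t)) = 112 * (x * t))%N by ring.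
  by clear; move: (x * t)%N => y; lia.
have t0 : (0 < t)%N by lia.
have bad := @bad_count_le R Q t i Q.+1 t0 _ gapQ; rewrite i0 iQ in bad.
have tI : (t <= i)%N by lia.
have N0 : (0 < N)%N by lia.
apply: le_trans (middle_box pp psiD psi_norm psi_neq1 t3 Qt Np N0 tI iN) _.
rewrite lerD2r mulrDr lerD //; last by rewrite mulrCA mulrA.
set x := Num.sqrt i%:R in bad *.
have xE : x ^+ 2 = i%:R by rewrite sqr_sqrtr.
have x1 : 1 <= x by rewrite -(@ler_pXn2r _ 2) ?nnegrE ?sqrtr_ge0 // xE expr1n ler1n.
have x0 : 0 < x by apply: lt_le_trans x1.
have d0 : (0 : R) < (n0 - i)%:R by rewrite ltr0n subn_gt0; lia.
(* This absorbs the constant term: 20 + 8 * 100 = 820. *)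
have W1 : 1 <= Q%:R * t%:R / x.
  rewrite ler_pdivlMr // mul1r; apply: le_trans (_ : i%:R <= _).
    by rewrite -xE expr2 ler_peMl // ltW.
  by rewrite -natrM ler_nat; apply: leq_trans iQ _; rewrite leq_pmulr.
rewrite -!mulrA [820 * _]mulrC -!mulrA ler_wpM2l // invfM.
have -> : Q%:R * (t%:R * ((x^-1 / (n0 - i)%:R) * 820)) = 820 * (Q%:R * t%:R / x) / (n0 - i)%:R by ring.
rewrite -/n0 ler_wpM2r ?invr_ge0 ?(ltW d0) //.
by have := bad isT; lra.
Qed.

(** The first use of [log_weight], then a sum over levels: at most 57 t levels near the ends cost 2
    N each, and [sum_weights_le] sums the middle ones. *)
Lemma char_sum_bound :
  ln N%:R * nc (\sum_(1 <= n < N.+1) f n) <=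
  5050 * N%:R * (Q%:R * t%:R ^+ 2 / Num.sqrt n0%:R).
Proof.
have f1 n : nc (f n) <= 1 by rewrite psi_norm.
have N0 : (0 < N)%N by lia.
have tt : (0 < t)%N by lia.
have n0_gt0 : (0 < n0)%N by rewrite trunc_log_gt0.
have n0Q : (n0 <= Q)%N by apply: leq_trunc_log; exact: ltnW.
have n0t : (n0 < 2 ^ t)%N by apply: leq_ltn_trans Qt.
apply: le_trans (log_weight N f1) _.
have NR : (0 : R) <= N%:R by [].
have t0 : (0 : R) < (2 ^ t)%:R by rewrite ltr0n expn_gt0.
(* [S1] and [S2] mark the two end ranges; [w] and [S3] are terms of [box_middle] extended by zero,
   so that one inequality covers every level. *)
pose S1 (i : nat) : R := (i < 56 * t)%:R; pose S2 (i : nat) : R := (n0 < i + t)%:R.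
have [w wE] : exists w : nat -> R, forall i, w i =
    if (0 < i < n0)%N then (Num.sqrt i%:R * (n0 - i)%:R)^-1 else 0 by eexists.
have [S3 S3E] : exists S3 : nat -> R, forall i, S3 i =
    if (i + t <= n0)%N then (2 ^ i.+1)%:R else 0 by eexists.
have w0 i : 0 <= w i by rewrite wE; case: ifP => // _; rewrite invr_ge0 mulr_ge0 ?sqrtr_ge0.
have S30 i : 0 <= S3 i by rewrite S3E; case: ifP.
have Ei i : E i <= 2 * N%:R * S1 i + 2 * N%:R * S2 i + 820 * N%:R * (Q%:R * t%:R) * w i +
    10 * N%:R / (2 ^ t)%:R + S3 i.
  have c0 : 0 <= 820 * N%:R * (Q%:R * t%:R) * w i :> R.
    by apply: mulr_ge0; [rewrite !mulr_ge0 ?ler0n | exact: w0].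
  have c1 : 0 <= 10 * N%:R / (2 ^ t)%:R :> R by rewrite divr_ge0 ?mulr_ge0.
  have c2 := S30 i; have tr := box_trivial i.
  have [a|a] := ltnP i (56 * t).
    have -> : S1 i = 1 by rewrite /S1 a.
    have : 0 <= 2 * N%:R * S2 i by rewrite !mulr_ge0.
    by lra.
  have -> : S1 i = 0 by rewrite /S1 ltnNge a.
  have [b|b] := ltnP n0 (i + t).
    have -> : S2 i = 1 by rewrite /S2 b.
    by lra.
  have -> : S2 i = 0 by rewrite /S2 ltnNge b.
  have := box_middle a b.
  have -> : w i = (Num.sqrt i%:R * (n0 - i)%:R)^-1.
    by rewrite wE ifT //; move: a b t3; clear; move: n0 => n; lia.
  have -> : S3 i = (2 ^ i.+1)%:R by rewrite S3E b.
  by lra.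
have -> : 5050 * N%:R * (Q%:R * t%:R ^+ 2 / Num.sqrt n0%:R) =
  5 * N%:R + (5050 * N%:R * (Q%:R * t%:R ^+ 2 / Num.sqrt n0%:R) - 5 * N%:R) :> R by ring.
rewrite lerD2l; apply: le_trans (normc_sum _ _ _) _.
rewrite (@sum_lev _ N n0.+1) => [|r /andP[r1 rN]]; last first.
  by rewrite ltnS /lev leq_trunc_log //; lia.
apply: le_trans (_ : \sum_(i < n0.+1) E i <= _).
  apply: ler_sum => i _; apply: ler_sum => q _.
  by rewrite Normc.normcM normc_real ger0_norm ?ln_nat_ge0.
apply: le_trans (_ : \sum_(i < n0.+1) (2 * N%:R * S1 i + 2 * N%:R * S2 i +
    820 * N%:R * (Q%:R * t%:R) * w i + 10 * N%:R / (2 ^ t)%:R + S3 i) <= _).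
  by apply: ler_sum => i _; exact: Ei.
rewrite !big_split /= -!mulr_sumr sumr_const card_ord.
have B1 : \sum_(i < n0.+1) S1 i <= 56 * t%:R.
  rewrite -natr_sum -natrM ler_nat -big_mkcond sum1_card.
  apply: leq_trans (_ : #|[set i : 'I_n0.+1 | (i < 56 * t)%N]| <= _)%N.
    by rewrite cardsE.
  by apply: card_spread => x y; rewrite !inE => _ h _; rewrite ltn_addl.
have B2 : \sum_(i < n0.+1) S2 i <= t%:R.
  rewrite -natr_sum ler_nat -big_mkcond sum1_card.
  apply: leq_trans (_ : #|[set i : 'I_n0.+1 | (n0 < i + t)%N]| <= _)%N.
    by rewrite cardsE.
  by apply: card_spread => x y; rewrite !inE => h _ _; apply: leq_ltn_trans h; rewrite -ltnS.
have B3 : \sum_(i < n0.+1) w i <= 6 * (t%:R / Num.sqrt n0%:R).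
  have n0tt : (0 < n0 <= 2 ^ t)%N by rewrite n0_gt0 ltnW.
  apply: le_trans (sum_weights_le R tt n0tt).
  rewrite -(big_mkord predT w) big_nat_recr //= big_ltn // wE /= add0r.
  rewrite wE ltnn andbF addr0 big_nat_cond [leRHS]big_nat_cond.
  by apply: ler_sum => i /andP[hi _]; rewrite wE hi.
have B4 : 10 * N%:R / (2 ^ t)%:R *+ n0.+1 <= 10 * N%:R :> R.
  rewrite -[_ *+ n0.+1]mulr_natl mulrA ler_pdivrMr // mulrC ler_wpM2l ?mulr_ge0 //.
  by rewrite ler_nat.
(* The sum is empty if n0 < t, and otherwise at most 2^(n0 - t + 2) <= 2^n0. *)
have B5 : \sum_(i < n0.+1) S3 i <= N%:R.
  apply: le_trans (_ : (2 ^ n0)%:R <= _); last by rewrite ler_nat trunc_logP.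
  have g n : (\sum_(i < n) 2 ^ i.+1 <= 2 ^ n.+1)%N.
    elim: n => [|n IH]; first by rewrite big_ord0.
    by rewrite big_ord_recr /= [X in (_ <= X)%N]expnS mul2n -addnn leq_add2r.
  have [tn|tn] := leqP t n0; last first.
    by rewrite big1 // => i _; rewrite S3E ifF //;
      apply: contraTF tn => h; rewrite -leqNgt (leq_trans _ h) ?leq_addl.
  apply: le_trans (_ : (\sum_(i < (n0 - t).+1) 2 ^ i.+1)%N%:R <= _); last first.
    by rewrite ler_nat; apply: leq_trans (g _) _; rewrite leq_exp2l //;
      move: tn t3; clear; move: n0 => n; lia.
  rewrite natr_sum (big_ord_widen n0.+1 (fun i => (2 ^ i.+1)%:R)) ?ltnS ?leq_subr //.
  rewrite [leRHS]big_mkcond; apply: ler_sum => i _; rewrite S3E.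
  have -> : (i + t <= n0)%N = (i < (n0 - t).+1)%N by rewrite ltnS leq_subRL // addnC.
  by [].
(* As sqrt n0 <= n0 <= Q, the end levels, of total O(N t), are absorbed in the main term. *)
have Z1 : t%:R <= Q%:R * t%:R ^+ 2 / Num.sqrt n0%:R :> R.
  have x0 : 0 < Num.sqrt (n0%:R : R) by rewrite sqrtr_gt0 ltr0n.
  rewrite ler_pdivlMr // mulrC expr2 mulrA ler_wpM2r //.
  apply: le_trans (_ : n0%:R <= _).
    rewrite -(@ler_pXn2r _ 2) ?nnegrE ?sqrtr_ge0 // sqr_sqrtr // -natrX ler_nat.
    by rewrite -mulnn leq_pmulr.
  by rewrite -natrM ler_nat (leq_trans n0Q) // leq_pmulr.
have tR : (3 : R) <= t%:R by rewrite (ler_nat R 3).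
set Z := Q%:R * t%:R ^+ 2 / _ in Z1 *.
have B3' : 820 * N%:R * (Q%:R * t%:R) * (\sum_(i < n0.+1) w i) <= N%:R * (4920 * Z).
  have K0 : 0 <= 820 * N%:R * (Q%:R * t%:R) :> R by rewrite !mulr_ge0 ?ler0n.
  apply: le_trans (ler_wpM2l K0 B3) _.
  by rewrite /Z le_eqVlt; apply/orP; left; apply/eqP; ring.
have B1' := ler_wpM2l (mulr_ge0 (ler0n R 2) NR) B1.
have B2' := ler_wpM2l (mulr_ge0 (ler0n R 2) NR) B2.
(* 114 t + 16 <= 130 t <= 130 Z, and 5050 = 820 * 6 + 130. *)
have fin : 2 * N%:R * (56 * t%:R) + 2 * N%:R * t%:R + 10 * N%:R + N%:R + 5 * N%:R <= N%:R * (130 * Z).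
  have -> : 2 * N%:R * (56 * t%:R) + 2 * N%:R * t%:R + 10 * N%:R + N%:R + 5 * N%:R =
     N%:R * (114 * t%:R + 16) :> R by ring.
  by rewrite ler_wpM2l //; lra.
by lra.
Qed.

End CharSum.

(** * The additive character attached to a *)

Section AdditiveCharacter.
Variables (R : realType) (p : nat).
Hypothesis pp : prime p.

Lemma e_mod_norm z : Normc.normc (e_mod R p z) = 1.
Proof. by rewrite /e_mod /= cos2Dsin2 sqrtr1. Qed.

Lemma e_mod_modz (a z : int) : e_mod R p (a * z) = e_mod R p (a * (z %% p%:Z)%Z).
Proof.
rewrite {1}(divz_eq z p%:Z) mulrDr e_modD mulrA e_mod_period ?mul1r //.
exact: prime_gt0.
Qed.

(** For p > 2 the imaginary part sin (2 pi / p) is positive. *)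
Lemma e_mod1_neq1 : (2 < p)%N -> e_mod R p 1 != 1.
Proof.
move=> p2; apply/eqP => /(congr1 (@complex.Im R)); rewrite /e_mod /= => /eqP.
apply/negP; rewrite gt_eqF // mulr1.
have p0 : (0 : R) < p%:R by rewrite ltr0n; lia.
have pi0 := pi_gt0 R.
apply: sin_gt0_pi; rewrite divr_gt0 ?mulr_gt0 //= ltr_pdivrMr // mulrC ltr_pM2l //.
by rewrite (ltr_nat R 2).
Qed.

Variable a : int.
Definition e_char (x : 'F_p) : R[i] := e_mod R p (a * (x : nat)%:Z).

Lemma e_charD x y : e_char (x + y) = e_char x * e_char y.
Proof.
rewrite /e_char -e_modD -mulrDr -PoszD [RHS]e_mod_modz modz_nat; congr (e_mod R p (a * Posz _)).
have e : nat_of_ord (x + y)%R = ((x + y)%N %% (Zp_trunc (pdiv p)).+2)%N by [].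
by rewrite e; congr (_ %% _)%N; exact: Fp_cast.
Qed.

(** At an inverse x of a modulo p the value is e_p(1). *)
Lemma e_char_neq1 : (2 < p)%N -> coprimez a p%:Z -> exists x, e_char x != 1.
Proof.
move=> p2 /coprimezP[[u v] /= uv]; exists ((`|u %% p%:Z|%Z)%N%:R).
have pz : p%:Z != 0 by rewrite eqz_nat -lt0n prime_gt0.
have lt : (`|(u %% p%:Z)%Z| < p)%N.
  by rewrite -ltz_nat gez0_abs ?modz_ge0 // ltz_pmod // ltz_nat prime_gt0.
rewrite /e_char val_Fp_nat // modn_small // gez0_abs ?modz_ge0 // -e_mod_modz.
apply: contraNneq (e_mod1_neq1 p2) => e; rewrite -uv e_modD e_mod_period ?prime_gt0 //.
by rewrite mulr1 mulrC e.
Qed.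

End AdditiveCharacter.

(** * Choice of the parameters and return to natural logarithms *)

Unset Implicit Arguments.

Theorem theorem16 (R : realType) :
  exists (C : R) (p0 : nat), 0 < C /\
    forall p N : nat, prime p -> (p0 <= p)%N -> (2 <= N < p)%N ->
      max_kloosterman R p N <=
        C * (ln (ln (p%:R : R)) ^+ 3 * ln (p%:R : R)
             / (ln (N%:R : R) `^ (3 / 2))) * N%:R.
Proof.
(* p0 exceeds e^e, so that ln ln p >= 1; 10^6 exceeds the final constant 10100 * 98. *)
exists (1000 * 1000), (Num.trunc (expR (expR (1 : R)))).+3.
split=> [|p N pp]; first by rewrite mulr_gt0 ?ltr0n.
move=> p0p /andP[N2 Np].
have l1 := ln2_le1 R; have l2 := ln2_ge_half R.
have pgt : expR (expR 1) < p%:R :> R.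
  by apply: lt_le_trans (truncnS_gt _) _; rewrite ler_nat ltnW // ltnW.
have p2 : (2 < p)%N by apply: leq_trans p0p.
have p0 : (0 : R) < p%:R by rewrite ltr0n prime_gt0.
set L : R := ln p%:R.
have L0 : expR 1 <= L.
  by rewrite -[leLHS]expRK ler_ln ?posrE ?expR_gt0 // ltW.
have Lpos : 0 < L by apply: lt_le_trans L0; exact: expR_gt0.
set l : R := ln L.
have l0 : 1 <= l by rewrite -[leLHS]expRK ler_ln ?posrE ?expR_gt0.
(* t is the size of log log p: large enough for 2^t > Q and t >= 3. *)
pose Q := trunc_log 2 p; pose t := (trunc_log 2 Q + 3)%N; pose n0 := trunc_log 2 N.
have Q0 : (0 < Q)%N by rewrite trunc_log_gt0 (ltn_trans _ p2).
have [[a ca ->] _] := max_kloosterman_attained R N pp.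
have Qt : (Q < 2 ^ t)%N.
  by apply: leq_trans (trunc_log_ltn Q (isT : 1 < 2)%N) _; rewrite leq_exp2l // /t addn3 !ltnS leqW.
have t3 : (3 <= t)%N by rewrite /t leq_addl.
have := char_sum_bound pp (e_charD R pp a) (fun x => e_mod_norm R p _)
  (e_char_neq1 R pp p2 ca) t3 Qt Np N2.
rewrite -[X in ln _ * Normc.normc X]/(kloosterman_sum R p N a).
set S := Normc.normc _ => hS.
have S0 : 0 <= S by exact: normc_ge0.
have QL : Q%:R <= 2 * L.
  have b1 : Q%:R * ln 2 <= L.
    rewrite mulr_natl -lnXn ?ltr0n // -natrX ler_ln ?posrE ?ltr0n ?expn_gt0 ?(prime_gt0 pp) //.
    by rewrite ler_nat trunc_logP // prime_gt0.
  have b2 := ler_wpM2l (ler0n R Q) l2.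
  by lra.
(* ln Q <= ln 2 + l and ln 2 >= 1/2 give log_2 Q <= 2 + 2 l, hence t <= 5 + 2 l <= 7 l as l >= 1. *)
have tl : t%:R <= 7 * l.
  have a1 : (trunc_log 2 Q)%:R * ln 2 <= ln (Q%:R : R).
    rewrite mulr_natl -lnXn ?ltr0n // -natrX ler_ln ?posrE ?ltr0n ?expn_gt0 //.
    by rewrite ler_nat trunc_logP.
  have a2 : ln (Q%:R : R) <= ln 2 + l.
    by rewrite -lnM ?posrE // ler_ln ?posrE ?ltr0n ?mulr_gt0.
  have a3 := ler_wpM2l (ler0n R (trunc_log 2 Q)) l2.
  by rewrite /t natrD; lra.
set M : R := ln N%:R in hS *.
have n0_gt0 : (0 < n0)%N by rewrite trunc_log_gt0.
have M0 : 0 < M by rewrite ln_gt0 // (ltr_nat R 1).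
(* The constant 4 is a perfect square, for the comparison of square roots that follows. *)
have Mn0 : M <= 4 * n0%:R.
  apply: le_trans (_ : ln ((2 ^ n0.+1)%:R : R) <= _).
    rewrite ler_ln ?posrE ?ltr0n ?expn_gt0 ?(ltn_trans _ N2) //.
    by rewrite ler_nat ltnW // trunc_log_ltn.
  rewrite natrX lnXn ?ltr0n // -[_ *+ n0.+1]mulr_natl.
  have c1 : (1 : R) <= n0%:R by rewrite ler1n.
  have c2 := ler_wpM2l (addr_ge0 (ler0n R n0) ler01) l1.
  by rewrite -natr1; lra.
have sM : Num.sqrt M <= 2 * Num.sqrt n0%:R.
  rewrite -(@ler_pXn2r _ 2) ?nnegrE ?mulr_ge0 ?sqrtr_ge0 // exprMn !sqr_sqrtr ?(ltW M0) //.
  by rewrite -natrX.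
have x0 : 0 < Num.sqrt (n0%:R : R) by rewrite sqrtr_gt0 ltr0n.
have y0 : 0 < Num.sqrt M by rewrite sqrtr_gt0.
have -> : M `^ (3 / 2) = M * Num.sqrt M.
  have -> : 3 / 2 = 1 + 2^-1 :> R by lra.
  by rewrite powRD ?gt_eqF ?implybT // powRr1 ?(ltW M0) // powR12_sqrt // ltW.
have MS0 : 0 < M * Num.sqrt M by rewrite mulr_gt0.
have -> : 1000 * 1000 * (l ^+ 3 * L / (M * Num.sqrt M)) * N%:R =
  1000 * 1000 * (l ^+ 3 * L) * N%:R / (M * Num.sqrt M) by ring.
rewrite ler_pdivlMr // mulrCA mulrA.
apply: le_trans (ler_wpM2r (ltW y0) hS) _.
apply: le_trans (_ : 5050 * N%:R * (Q%:R * t%:R ^+ 2 / Num.sqrt n0%:R) * (2 * Num.sqrt n0%:R) <= _).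
  by apply: ler_wpM2l; [rewrite !mulr_ge0 ?invr_ge0 ?sqrtr_ge0 ?exprn_ge0 ?ler0n | exact: sM].
have -> : 5050 * N%:R * (Q%:R * t%:R ^+ 2 / Num.sqrt n0%:R) * (2 * Num.sqrt n0%:R) =
   10100 * N%:R * (Q%:R * t%:R ^+ 2) :> R.
  by rewrite -/n0; field; rewrite gt_eqF.
(* l >= 1 turns the square of log log p into the cube of the statement. *)
have t2 : t%:R ^+ 2 <= 49 * l ^+ 3.
  apply: le_trans (_ : (7 * l) ^+ 2 <= _).
    by rewrite lerXn2r ?nnegrE // mulr_ge0 //; lra.
  rewrite exprMn -natrX ler_wpM2l // [leRHS]exprSr ler_peMr // exprn_ge0 //; lra.
have QT : Q%:R * t%:R ^+ 2 <= 2 * L * (49 * l ^+ 3).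
  by rewrite ler_pM ?exprn_ge0.
apply: le_trans (_ : 10100 * N%:R * (2 * L * (49 * l ^+ 3)) <= _).
  by apply: ler_wpM2l; [rewrite mulr_ge0 ?ler0n | exact: QT].
have -> : 10100 * N%:R * (2 * L * (49 * l ^+ 3)) = 10100 * 98 * (l ^+ 3 * L) * N%:R by ring.
have l3 : 0 <= l ^+ 3 * L by rewrite mulr_ge0 ?(ltW Lpos) // exprn_ge0 // (le_trans ler01).
apply: ler_wpM2r; first exact: ler0n.
by apply: ler_wpM2r; [exact: l3 | lra].
Qed.
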